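(* Let $(V,\omega)$ and $(V,\omega')$ be two vertex operator algebra structures on the same underlying vertex algebra $V$, and let $g$ be an automorphism of both structures of finite order $T$. Then $(V,\omega)$ is $g$-rational if and only if $(V,\omega')$ is $g$-rational. That is, the $g$-rationality of a vertex operator algebra is independent of the choice of the conformal vector.
   Context: All vector spaces are over $\mathbb{C}$, and $\mathbb{N}=\{0,1,2,\dots\}$. A vertex algebra is a vector space $V$ with a linear map $Y(\cdot,x):V\to(\operatorname{End}V)[[x,x^{-1}]]$, $v\mapsto Y(v,x)=\sum_{n\in\mathbb{Z}}v_nx^{-n-1}$, and a vector $\mathbf{1}\in V$ such that for all $u,v\in V$: $Y(\mathbf{1},z)=\operatorname{id}_V$ and $u_n\mathbf{1}=\delta_{n,-1}u$ for $n\ge -1$; $u_nv=0$ for $n$ sufficiently large; and the Jacobi identity $$z_0^{-1}\delta\left(\tfrac{z_1-z_2}{z_0}\right)Y(u,z_1)Y(v,z_2)-z_0^{-1}\delta\left(\tfrac{z_2-z_1}{-z_0}\right)Y(v,z_2)Y(u,z_1)=z_2^{-1}\delta\left(\tfrac{z_1-z_0}{z_2}\right)Y(Y(u,z_0)v,z_2)$$ holds, where $\delta(z)=\sum_{k\in\mathbb{Z}}z^k$ and binomials are expanded in nonnegative powers of the second variable. Put $\mathcal{D}v=v_{-2}\mathbf{1}$. A conformal vector of $V$ is $\omega\in V$ such that, with $L(n)=\omega_{n+1}$: $[L(m),L(n)]=(m-n)L(m+n)+\frac{m^3-m}{12}\delta_{m+n,0}c_V$ for some $c_V\in\mathbb{C}$;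 $L(-1)=\mathcal{D}$; $L(0)$ is semisimple, $V=\bigoplus_{n\in\mathbb{C}}V_n$ with $L(0)|_{V_n}=n\operatorname{id}$; and each $L(n)$, $n\ge1$, acts locally nilpotently. A vertex operator algebra $(V,\omega)$ is a vertex algebra with a conformal vector such that $V_n=0$ unless $n\in\mathbb{Z}$, $\dim V_n<\infty$ for all $n\in\mathbb{Z}$, and $V_n=0$ for $n$ sufficiently small. For $u\in V_n$, $\operatorname{wt}u=n$. An automorphism of $(V,\omega)$ is a linear isomorphism $g$ with $g(\mathbf{1})=\mathbf{1}$, $g(Y(u,z)v)=Y(g(u),z)g(v)$ and $g(\omega)=\omega$. For $g$ of finite order $T$, $V=\bigoplus_{r=0}^{T-1}V^r$ with $V^r=\{v\in V\mid gv=e^{-2\pi\sqrt{-1}r/T}v\}$. A weak $g$-twisted $V$-module is a vector space $M$ with a linear map $Y_M(\cdot,z):V\to(\operatorname{End}M)[[z^{1/T},z^{-1/T}]]$, with $Y_M(u,z)=\sum_{n\in r/T+\mathbb{Z}}u_nz^{-n-1}$ for $u\in V^r$, $0\le r\le T-1$, such that: $Y_M(\mathbf{1},z)=\operatorname{id}_M$; for $u\in V^r$, $w\in M$, $u_{r/T+n}w=0$ for $n$ sufficiently large; and for $u\in V^r$, $v\in V$, $$z_0^{-1}\delta\left(\tfrac{z_1-z_2}{z_0}\right)Y_M(u,z_1)Y_M(v,z_2)-z_0^{-1}\delta\left(\tfrac{z_2-z_1}{-z_0}\right)Y_M(v,z_2)Y_M(u,z_1)=z_2^{-1}\left(\tfrac{z_1-z_0}{z_2}\right)^{-r/T}\delta\left(\tfrac{z_1-z_0}{z_2}\right)Y_M(Y(u,z_0)v,z_2).$$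 An admissible $g$-twisted $(V,\omega)$-module is a weak $g$-twisted $V$-module with a grading $M=\bigoplus_{n\in(1/T)\mathbb{N}}M(n)$ such that $v_mM(n)\subseteq M(n+\operatorname{wt}v-m-1)$ for all homogeneous $v\in V$ and $m,n\in(1/T)\mathbb{Z}$ (with $M(k)=0$ for $k<0$), where $\operatorname{wt}$ is taken with respect to $\omega$. $(V,\omega)$ is $g$-rational if the category of admissible $g$-twisted $(V,\omega)$-modules is semisimple (i.e. every admissible $g$-twisted module is a direct sum of irreducible admissible $g$-twisted modules). *)

(* Defs.v *)
(* The field of complex numbers is R[i], for R : realType. *)
From mathcomp Require Import all_boot all_order all_algebra.
From mathcomp Require Import all_classical all_reals all_analysis.
From mathcomp Require Import complex.
Set Implicit Arguments.
Unset Strict Implicit.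
Unset Printing Implicit Defensive.
Import Order.TTheory GRing.Theory Num.Theory.
Local Open Scope classical_set_scope.
Local Open Scope ring_scope.

Definition is_subspace (K : pzRingType) (M : lmodType K) (N : set M) : Prop :=
  [/\ N 0,
      forall x y : M, N x -> N y -> N (x + y)
    & forall (a : K) (x : M), N x -> N (a *: x)].

(* N is the internal direct sum of the family of subspaces W; the sum over I
   is a sum over the finite support of f. *)
Definition is_direct_sum (K : pzRingType) (M : lmodType K) (I : choiceType)
    (N : set M) (W : I -> set M) : Prop :=
  [/\ forall i, is_subspace (W i),
      forall i, W i `<=` N
    & forall x, N x ->
        exists! f : I -> M,
          [/\ finite_set [set i | f i != 0],
              forall i, W i (f i)
            & x = \sum_(i \in [set: I]) f i]].

(* Formal series with rational exponents: (a, b, c) stands for z0^a z1^b z2^c; a series is the function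
   sending an exponent to its coefficient. *)
Definition expo : Type := (rat * rat * rat)%type.

(* Product of a scalar series and a vector-valued one.  The big operator is 0
   when infinitely many terms are nonzero; in the Jacobi identities below the
   truncation axioms make every coefficient a finite sum. *)
Definition series_mul (K : unitRingType) (M : lmodType K)
    (k : expo -> rat) (F : expo -> M) (x : expo) : M :=
  \sum_(p \in [set: expo]) ratr (k p) *: F (x - p).

Definition gbinom (s : rat) (i : nat) : rat :=
  (\prod_(j < i) (s - j%:R)) / i`!%:R.

(* Coefficient of x^p y^q in
   (x - y)^s = \sum_(i >= 0) (-1)^i gbinom s i x^(s - i) y^i. *)
Definition binom_coef (s p q : rat) : rat :=
  if (q \is a Num.nat) && (p == s - q)
  then (-1) ^+ Num.truncn q * gbinom s (Num.truncn q) else 0.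

(* z0^-1 delta((z1 - z2)/z0) = \sum_k z0^(-1-k) (z1 - z2)^k. *)
Definition delta_12 (x : expo) : rat :=
  let: (a, b, c) := x in
  if a \is a Num.int then binom_coef (-1 - a) b c else 0.

(* z0^-1 delta((z2 - z1)/(-z0)) = \sum_k (-1)^k z0^(-1-k) (z2 - z1)^k. *)
Definition delta_21 (x : expo) : rat :=
  let: (a, b, c) := x in
  if a \is a Num.int
  then (-1) ^ Num.floor (-1 - a) * binom_coef (-1 - a) c b else 0.

(* z2^-1 ((z1 - z0)/z2)^s delta((z1 - z0)/z2)
     = \sum_k z2^(-1-s-k) (z1 - z0)^(s+k),  k ranging over the integers. *)
Definition delta_10 (s : rat) (x : expo) : rat :=
  let: (a, b, c) := x in
  if -1 - c - s \is a Num.int then binom_coef (-1 - c) b a else 0.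

(* Modes indexed by integers, viewed as modes indexed by rationals. *)
Definition mode_rat (A B V : nmodType) (Y : A -> int -> B -> V)
    (u : A) (n : rat) (v : B) : V :=
  if n \is a Num.int then Y u (Num.floor n) v else 0.

(* The Jacobi identity with the factor ((z1 - z0)/z2)^s on the right, applied
   to w.  YV u n and YM u n are the coefficients of z^(-n-1) in Y(u, z) and
   Y_M(u, z). *)
Definition jacobi (K : unitRingType) (V M : lmodType K)
    (YV : V -> rat -> V -> V) (YM : V -> rat -> M -> M)
    (s : rat) (u v : V) (w : M) : Prop :=
  let YuYv (x : expo) : M := let: (a, b, c) := x in
    if a == 0 then YM u (-1 - b) (YM v (-1 - c) w) else 0 in
  let YvYu (x : expo) : M := let: (a, b, c) := x in
    if a == 0 then YM v (-1 - c) (YM u (-1 - b) w) else 0 in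
  let YYuv (x : expo) : M := let: (a, b, c) := x in
    if b == 0 then YM (YV u (-1 - a) v) (-1 - c) w else 0 in
  forall x : expo,
    series_mul delta_12 YuYv x - series_mul delta_21 YvYu x
    = series_mul (delta_10 s) YYuv x.

(* va_mode u n v is u_n v. *)
Record vertexAlgebra (R : realType) : Type := VertexAlgebra {
  va_sort :> lmodType R[i];
  va_mode : va_sort -> int -> va_sort -> va_sort;
  va_vac : va_sort;
  va_linearl : forall (n : int) (v : va_sort), linear (fun u => va_mode u n v);
  va_linearr : forall (u : va_sort) (n : int), linear (va_mode u n);
  va_vacl : forall (n : int) (v : va_sort),
    va_mode va_vac n v = if n == -1 then v else 0;
  va_vacr : forall (u : va_sort) (n : int), -1 <= n ->
    va_mode u n va_vac = if n == -1 then u else 0;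
  va_trunc : forall u v : va_sort,
    exists N : int, forall n : int, N <= n -> va_mode u n v = 0;
  va_jacobi : forall u v w : va_sort,
    jacobi (mode_rat va_mode) (mode_rat va_mode) 0 u v w
}.

(* The operator v |-> v_{-2} 1. *)
Definition va_D (R : realType) (V : vertexAlgebra R) (v : V) : V :=
  va_mode v (-2) (va_vac V).

Definition vir (R : realType) (V : vertexAlgebra R) (w : V) (n : int) (v : V)
  : V := va_mode w (n + 1) v.

Definition wt_space (R : realType) (V : vertexAlgebra R) (w : V) (n : R[i])
  : set V := [set v | vir w 0 v = n *: v].

Record is_conformal (R : realType) (V : vertexAlgebra R) (w : V) : Prop :=
  IsConformal {
  conf_virasoro : exists c : R[i], forall (m n : int) (v : V),
    vir w m (vir w n v) - vir w n (vir w m v)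
    = (m - n)%:~R *: vir w (m + n) v
      + ((if m + n == 0 then (m ^+ 3 - m)%:~R / 12%:R else 0) * c) *: v;
  conf_D : forall v : V, vir w (-1) v = va_D v;
  conf_L0_semisimple : is_direct_sum [set: V] (wt_space w);
  conf_loc_nilp : forall (n : int) (v : V), 1 <= n ->
    exists k : nat, iter k (vir w n) v = 0
}.

Record is_voa (R : realType) (V : vertexAlgebra R) (w : V) : Prop := IsVOA {
  voa_conformal : is_conformal w;
  voa_int : forall n : R[i], (forall k : int, n != k%:~R) ->
    wt_space w n = [set 0];
  voa_findim : forall n : int, exists (d : nat) (b : 'I_d -> V),
    (forall i, wt_space w n%:~R (b i)) /\
    (forall v, wt_space w n%:~R v ->
       exists c : 'I_d -> R[i], v = \sum_(i < d) c i *: b i);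
  voa_bounded : exists N : int, forall n : int, n <= N ->
    wt_space w n%:~R = [set 0]
}.

Record is_voa_aut (R : realType) (V : vertexAlgebra R) (w : V)
    (g : {linear V -> V}) : Prop := IsVOAAut {
  aut_bij : bijective g;
  aut_vac : g (va_vac V) = va_vac V;
  aut_mode : forall (u : V) (n : int) (v : V),
    g (va_mode u n v) = va_mode (g u) n (g v);
  aut_conf : g w = w
}.

Definition has_order (R : realType) (V : vertexAlgebra R)
    (g : {linear V -> V}) (T : nat) : Prop :=
  [/\ (0 < T)%N, iter T g =1 id
    & forall k : nat, (0 < k)%N -> iter k g =1 id -> (T <= k)%N].

(* exp(-2 pi i r/T) = cos (2 pi r/T) - i sin (2 pi r/T). *)
Definition root_of_unity (R : realType) (T r : nat) : R[i] :=
  let t : R := 2 * pi * r%:R / T%:R in (cos t -i* sin t)%C.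

Definition aut_eigenspace (R : realType) (V : vertexAlgebra R)
    (g : {linear V -> V}) (T r : nat) : set V :=
  [set v | g v = root_of_unity R T r *: v].

Definition in_invTZ (T : nat) (n : rat) : Prop := T%:R * n \is a Num.int.
Definition in_invTN (T : nat) (n : rat) : Prop := T%:R * n \is a Num.nat.

(* tm_mode u n w is u_n w.  Here T is meant to be the order of g. *)
Record weakTwistedModule (R : realType) (V : vertexAlgebra R)
    (g : {linear V -> V}) (T : nat) : Type := WeakTwistedModule {
  tm_sort :> lmodType R[i];
  tm_mode : V -> rat -> tm_sort -> tm_sort;
  tm_linearl : forall (n : rat) (w : tm_sort), linear (fun u => tm_mode u n w);
  tm_linearr : forall (u : V) (n : rat), linear (tm_mode u n);
  tm_invTZ : forall (u : V) (n : rat) (w : tm_sort),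
    ~ in_invTZ T n -> tm_mode u n w = 0;
  tm_expo : forall (r : nat) (u : V) (n : rat) (w : tm_sort),
    (r < T)%N -> aut_eigenspace g T r u ->
    n - r%:R / T%:R \isn't a Num.int -> tm_mode u n w = 0;
  tm_vac : forall (n : rat) (w : tm_sort),
    tm_mode (va_vac V) n w = if n == -1 then w else 0;
  tm_trunc : forall (r : nat) (u : V) (w : tm_sort),
    (r < T)%N -> aut_eigenspace g T r u ->
    exists N : int, forall n : int, N <= n ->
      tm_mode u (r%:R / T%:R + n%:~R) w = 0;
  tm_jacobi : forall (r : nat) (u v : V) (w : tm_sort),
    (r < T)%N -> aut_eigenspace g T r u ->
    jacobi (mode_rat (@va_mode R V)) tm_mode (- (r%:R / T%:R)) u v w
}.

(* The grading is indexed by all rationals, with zero components outside of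
   (1/T)N. *)
Record admissibleModule (R : realType) (V : vertexAlgebra R) (w : V)
    (g : {linear V -> V}) (T : nat) : Type := AdmissibleModule {
  am_weak :> weakTwistedModule g T;
  am_grade : rat -> set am_weak;
  am_grade0 : forall n : rat, ~ in_invTN T n -> am_grade n = [set 0];
  am_direct : is_direct_sum [set: am_weak] am_grade;
  am_mode_grade : forall (k : int) (v : V) (m n : rat) (x : am_weak),
    wt_space w k%:~R v -> in_invTZ T m -> in_invTZ T n ->
    am_grade n x -> am_grade (n + k%:~R - m - 1) (tm_mode v m x)
}.

(* N is a submodule which is graded by its intersections with the components
   of M, i.e. an admissible module in its own right. *)
Definition is_adm_submodule (R : realType) (V : vertexAlgebra R) (w : V)
    (g : {linear V -> V}) (T : nat) (M : admissibleModule w g T) (N : set M)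
  : Prop :=
  [/\ is_subspace N,
      forall (v : V) (n : rat) (x : M), N x -> N (tm_mode v n x)
    & is_direct_sum N (fun n => N `&` am_grade n)].

Definition is_irr_adm_submodule (R : realType) (V : vertexAlgebra R) (w : V)
    (g : {linear V -> V}) (T : nat) (M : admissibleModule w g T) (N : set M)
  : Prop :=
  [/\ is_adm_submodule N, N <> [set 0]
    & forall N' : set M, is_adm_submodule N' -> N' `<=` N ->
        N' = [set 0] \/ N' = N].

Definition g_rational (R : realType) (V : vertexAlgebra R) (w : V)
    (g : {linear V -> V}) (T : nat) : Prop :=
  forall M : admissibleModule w g T,
    exists (I : choiceType) (N : I -> set M),
      (forall i, is_irr_adm_submodule (N i)) /\ is_direct_sum [set: M] N.

(* Main.v *)
(* Write L(n) = w_(n+1) and, for u of weight k, o_m(u) = u_(k-1+m), an operator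
   of degree -m. In terms of the modes o_m, the twisted Jacobi identity is the
   Borcherds identity on the cylinder: its left-hand side involves the o_m only,
   and its right-hand side is o_(m+n+l) applied to
     C_(l,m)(u, v) = Res_x e^(mx) (e^x - 1)^l Y[u, x]v,
   where Y[u, x] = Y(e^(x L(0)) u, e^x - 1). Zhu's vertex algebra (V, Y[.,.]) is
   isomorphic to (V, Y), whatever the conformal vector: the operator
     E = \sum_(n >= 0) e_n L(n), where (1 + y) log(1 + y) = \sum_n e_n y^(n+1),
   grades Y[.,.], it is L(0) up to terms lowering the weight, so that
   E T = T L(0) for a unique unipotent T, and comparing leading terms shows that
   T carries Y to Y[.,.]. Hence phi = T' T^-1 intertwines the cylinder products
   of w and w', and o_m(u) := o'_m(phi u) turns an admissible module for w'
   into one for w, with the same grading and the same submodules. *)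
From HB Require Import structures.
Require Import Defs.
From mathcomp Require Import all_boot all_order all_algebra.
From mathcomp Require Import all_classical all_reals all_analysis.
From mathcomp Require Import complex ring lra zify.
Set Implicit Arguments.
Unset Strict Implicit.
Unset Printing Implicit Defensive.
Import Order.TTheory GRing.Theory Num.Theory.
Local Open Scope classical_set_scope.
Local Open Scope ring_scope.

(** * Sums of finite support *)

(** The modes of a module cannot be kept as they are: the degree of u_n depends on the weight of u,
    and weights change with the conformal vector. What both structures share is the degree, whence
    the modes indexed by it. [E] is Zhu's L[0]: in the coordinate y = e^x - 1 the Euler field x d/dx
    becomes (1 + y) log(1 + y) d/dy, and the residue of (1 + y) log(1 + y) Y(w, y) is \sum_n e_n
    L(n). Writing T as the exponential of a change of coordinates is avoided. For fixed [l] and [m],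
    the two sides of the claim about T solve the same inhomogeneous equation for [E], whose source
    involves larger values of [l] only, so that downward induction on [l] applies. Their difference
    is then an eigenvector of [E] for the weight of the common leading term, which cancels. The
    product [plane] to which T relates the cylinder is made from Y alone; hence the maps T and T'
    can be composed. The twist enters only by making [m] rational, which the binomial coefficients
    allow. *)

Definition fsupp (I : choiceType) (A : nmodType) (F : I -> A) : Prop :=
  exists r : seq I, forall i, i \notin r -> F i = 0.

Notation fsum F := (\sum_(i \in [set: _]) F i).

Section FiniteSums.
Variables (I : choiceType).

Lemma fsumE (A : nmodType) (r : seq I) (F : I -> A) : uniq r ->
  (forall i, i \notin r -> F i = 0) -> fsum F = \sum_(i <- r) F i.
Proof.
move=> ur Fr; rewrite (fsbigE r) //; first last.
  by move=> i _; exact: Fr.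
by apply: eq_bigl => i; rewrite mem_set.
Qed.

Lemma fsupp_uniq (A : nmodType) (F : I -> A) : fsupp F ->
  exists2 r : seq I, uniq r & forall i, i \notin r -> F i = 0.
Proof.
move=> [r Fr]; exists (undup r); first exact: undup_uniq.
by move=> i; rewrite mem_undup; exact: Fr.
Qed.

Lemma fsupp2 (A B : nmodType) (F : I -> A) (G : I -> B) : fsupp F -> fsupp G ->
  exists r : seq I, [/\ uniq r, forall i, i \notin r -> F i = 0
    & forall i, i \notin r -> G i = 0].
Proof.
move=> [r Fr] [s Gs]; exists (undup (r ++ s)); split.
- exact: undup_uniq.
- by move=> i; rewrite mem_undup mem_cat negb_or => /andP[/Fr].
- by move=> i; rewrite mem_undup mem_cat negb_or => /andP[_ /Gs].
Qed.

Lemma fsumD (A : nmodType) (F G : I -> A) : fsupp F -> fsupp G ->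
  fsum (fun i => F i + G i) = fsum F + fsum G.
Proof.
move=> sF sG; have [r [ur Fr Gr]] := fsupp2 sF sG.
rewrite !(fsumE ur) // ?big_split // => i ir.
by rewrite Fr // Gr // addr0.
Qed.

Lemma fsum_map (A B : nmodType) (f : A -> B) (F : I -> A) :
  f 0 = 0 -> {morph f : x y / x + y} -> fsupp F ->
  f (fsum F) = fsum (fun i => f (F i)).
Proof.
move=> f0 fD /fsupp_uniq[r ur Fr].
rewrite !(fsumE ur) // ?(big_morph f fD f0) // => i ir.
by rewrite Fr.
Qed.

Lemma fsupp_map (A B : nmodType) (f : I -> A -> B) (F : I -> A) :
  (forall i, f i 0 = 0) -> fsupp F -> fsupp (fun i => f i (F i)).
Proof. by move=> f0 [r Fr]; exists r => i /Fr ->. Qed.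

Lemma fsuppD (A : nmodType) (F G : I -> A) : fsupp F -> fsupp G ->
  fsupp (fun i => F i + G i).
Proof.
move=> sF sG; have [r [_ Fr Gr]] := fsupp2 sF sG.
by exists r => i ir; rewrite Fr // Gr // addr0.
Qed.

Lemma fsum1 (A : nmodType) (F : I -> A) (j : I) :
  (forall i, i != j -> F i = 0) -> fsum F = F j.
Proof.
move=> Fj; rewrite (@fsumE _ [:: j]) ?big_seq1 // => i.
by rewrite inE; exact: Fj.
Qed.

Lemma fsum_ind (A : nmodType) (Q : A -> Prop) (F : I -> A) :
  Q 0 -> (forall x y, Q x -> Q y -> Q (x + y)) -> (forall i, Q (F i)) ->
  Q (fsum F).
Proof. by move=> Q0 QD QF; apply: (big_ind Q). Qed.

Lemma eq_fsum (A : nmodType) (F G : I -> A) : F =1 G -> fsum F = fsum G.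
Proof. by move=> FG; apply: eq_fsbigr => i _. Qed.

End FiniteSums.

Lemma fsupp_nat (A : nmodType) (F : nat -> A) N :
  (forall i, (N <= i)%N -> F i = 0) -> fsupp F.
Proof.
move=> FN; exists (iota 0 N) => i; rewrite mem_iota /= add0n -leqNgt.
exact: FN.
Qed.

Lemma fsupp_natP (A : nmodType) (F : nat -> A) :
  fsupp F -> exists N, forall i, (N <= i)%N -> F i = 0.
Proof.
move=> [r Fr]; exists (\max_(i <- r) i.+1) => i Ni; apply: Fr; apply/negP => ir.
by move: Ni; rewrite leqNgt (leq_trans _ (leq_bigmax_seq _ ir _)).
Qed.

Lemma fsum_nat (A : nmodType) (F : nat -> A) N :
  (forall i, (N <= i)%N -> F i = 0) -> fsum F = \sum_(i < N) F i.
Proof.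
move=> FN; rewrite (@fsumE _ _ (iota 0 N)) ?iota_uniq //; last first.
  by move=> i; rewrite mem_iota /= add0n -leqNgt; exact: FN.
by rewrite -(big_mkord xpredT F) /index_iota subn0.
Qed.

(** * Linear maps given as plain functions *)

Section LinearMaps.
Variables (K : pzRingType) (A B : lmodType K) (f : A -> B).
Hypothesis fL : linear f.
Let fl : {linear A -> B} := HB.pack f (GRing.isLinear.Build _ _ _ _ f fL).
Lemma lin0 : f 0 = 0. Proof. exact: (linear0 fl). Qed.
Lemma linD : {morph f : x y / x + y}. Proof. exact: (linearD fl). Qed.
Lemma linB : {morph f : x y / x - y}. Proof. exact: (linearB fl). Qed.
Lemma linN : {morph f : x / - x}. Proof. exact: (linearN fl). Qed.
Lemma linZ a x : f (a *: x) = a *: f x. Proof. exact: (linearZ_LR fl). Qed.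
Lemma lin_sum (I : Type) (r : seq I) (P : pred I) (F : I -> A) :
  f (\sum_(i <- r | P i) F i) = \sum_(i <- r | P i) f (F i).
Proof. exact: (linear_sum fl). Qed.
Lemma lin_fsum (I : choiceType) (F : I -> A) : fsupp F ->
  f (fsum F) = fsum (fun i => f (F i)).
Proof. exact: (fsum_map lin0 linD). Qed.
End LinearMaps.

Lemma linearP_of (K : pzRingType) (A B : lmodType K) (f : A -> B) :
  {morph f : x y / x + y} -> (forall a x, f (a *: x) = a *: f x) -> linear f.
Proof. by move=> fD fZ a x y; rewrite fD fZ. Qed.

Lemma fsum_linear (K : pzRingType) (A B : lmodType K) (I : choiceType)
    (F : I -> A -> B) :
  (forall i, linear (F i)) -> (forall x, fsupp (F^~ x)) ->
  linear (fun x => fsum (F^~ x)).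
Proof.
move=> FL Fs; apply: linearP_of => [x y|a x].
  by rewrite -fsumD //; apply: eq_fsum => i; rewrite (linD (FL i)).
rewrite (fsum_map (f := fun z => a *: z)) ?scaler0 //; last first.
  by move=> ? ?; rewrite scalerDr.
by apply: eq_fsum => i; rewrite (linZ (FL i)).
Qed.

(** * Projections onto the summands of a direct sum *)

Section DirectSum.
Variables (K : pzRingType) (M : lmodType K) (I : choiceType) (W : I -> set M).
Hypothesis dW : is_direct_sum [set: M] W.

Let dec x : exists f : I -> M,
  [/\ finite_set [set i | f i != 0], forall i, W i (f i) & x = fsum f].
Proof. by case: dW => _ _ /(_ x Logic.I)[f [hf _]]; exists f. Qed.

Definition ds_proj (i : I) (x : M) : M := projT1 (cid (dec x)) i.

Lemma ds_proj_in i x : W i (ds_proj i x).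
Proof. by rewrite /ds_proj; case: cid => f []. Qed.

Lemma ds_proj_supp x : fsupp (ds_proj^~ x).
Proof.
rewrite /ds_proj; case: cid => f [/= /finite_seqP[s hs] _ _]; exists s => i.
move=> /= i_s; apply/eqP/negPn/negP => fi.
have : [set i | f i != 0] i by exact: fi.
by rewrite hs /= (negbTE i_s).
Qed.

Lemma ds_proj_sum x : x = fsum (ds_proj^~ x).
Proof. by rewrite /ds_proj; case: cid => f []. Qed.

Lemma ds_proj_uniq x (f : I -> M) : fsupp f -> (forall i, W i (f i)) ->
  x = fsum f -> forall i, ds_proj i x = f i.
Proof.
move=> sf Wf xf i.
have fin (h : I -> M) : fsupp h -> finite_set [set i | h i != 0].
  move=> [r hr]; apply: (sub_finite_set (B := [set` r])) => [j /= hj|].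
    by apply: contraNT hj => /hr ->.
  exact: finite_seq.
case: dW => _ _ /(_ x Logic.I)[h [_ hu]].
have e1 : h = f by apply: hu; split => //; exact: fin.
have e2 : h = ds_proj^~ x.
  apply: hu; split; [exact/fin/ds_proj_supp|exact: (ds_proj_in ^~ x)|].
  exact: ds_proj_sum.
by rewrite -e1 e2.
Qed.

Lemma ds_proj_linear i : linear (ds_proj i).
Proof.
case: dW => Wsub _ _ a x y.
apply: (@ds_proj_uniq _ (fun i => a *: ds_proj i x + ds_proj i y)).
- apply: fsuppD (ds_proj_supp y).
  exact: (fsupp_map (f := fun _ => *:%R a)) (fun=> scaler0 _ _) (ds_proj_supp x).
- move=> j; case: (Wsub j) => _ WD WZ; apply: WD (ds_proj_in _ _).
  exact: WZ (ds_proj_in _ _).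
- rewrite fsumD; [|exact: (fsupp_map (f := fun _ => *:%R a)) (fun=> scaler0 _ _) (ds_proj_supp x)|exact: ds_proj_supp].
  rewrite -(fsum_map (f := *:%R a)) ?scaler0 -?ds_proj_sum //.
    by move=> ? ?; rewrite scalerDr.
  exact: ds_proj_supp.
Qed.

Lemma ds_proj_id i j x : W i x -> ds_proj j x = if j == i then x else 0.
Proof.
move=> Wx; apply: (@ds_proj_uniq _ (fun j => if j == i then x else 0)).
- by exists [:: i] => k; rewrite inE => /negbTE ->.
- by move=> k; case: eqP => [->//|_]; case: dW => /(_ k)[].
- by rewrite (@fsum1 _ _ _ i) ?eqxx // => k /negbTE ->.
Qed.

End DirectSum.

(** * The Jacobi identity in components *)

(** Only the exponents [h i] with i < N contribute: off this ray the delta function or the other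
    series vanishes, and far along it truncation takes over. *)
Lemma series_mulE (K : numFieldType) (M : lmodType K) (k : expo -> rat)
    (F : expo -> M) (x : expo) (h : nat -> expo) (N : nat) :
  injective h ->
  (forall p, (forall i, (i < N)%N -> p <> h i) -> k p = 0 \/ F (x - p) = 0) ->
  series_mul k F x = \sum_(i < N) ratr (k (h i)) *: F (x - h i).
Proof.
move=> hinj hk; rewrite /series_mul (@fsumE _ _ (map h (iota 0 N))).
- rewrite big_map -(big_mkord xpredT (fun i => ratr (k (h i)) *: F (x - h i))).
  by rewrite /index_iota subn0.
- by rewrite map_inj_uniq ?iota_uniq.
- move=> p pN; have [i iN e|->|->] := hk p; last first.
  + by rewrite scaler0.
  + by rewrite rmorph0 scale0r.
  by move: pN; rewrite e map_f // mem_iota.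
Qed.

Lemma expoB (a b c a' b' c' : rat) :
  ((a, b, c) : expo) - (a', b', c') = (a - a', b - b', c - c').
Proof. by []. Qed.

Lemma binom_coef_nat (s p q : rat) (i : nat) : p = s - i%:R -> q = i%:R ->
  binom_coef s p q = (-1) ^+ i * gbinom s i.
Proof.
by move=> -> ->; rewrite /binom_coef Num.Theory.natr_nat eqxx /= Num.Theory.natrK.
Qed.

Lemma binom_coef_neq0 (s p q : rat) : binom_coef s p q != 0 ->
  exists i : nat, q = i%:R /\ p = s - i%:R.
Proof.
rewrite /binom_coef; case: ifP => [/andP[/natrP[i ->] /eqP ->] _|]; last by rewrite eqxx.
by exists i.
Qed.

(** Reversing the product changes the sign of every factor. In [delta_10] the power of z1 - z0
    varies with the term; this turns its coefficients into binomials of the fixed number [m]. *)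
Lemma gbinom_neg (m : rat) (i : nat) :
  (-1) ^+ i * gbinom (i%:R - 1 - m) i = gbinom m i.
Proof.
rewrite /gbinom mulrA; congr (_ / _).
have -> : (-1) ^+ i = \prod_(j < i) (-1) :> rat by rewrite prodr_const card_ord.
rewrite -big_split /= [RHS](reindex_inj rev_ord_inj) /=; apply: eq_bigr => j _.
by rewrite natrB // -natr1; ring.
Qed.

Section JacobiCoefficients.
Variables (K : numFieldType) (V M : lmodType K).
Variables (YV : V -> rat -> V -> V) (YM : V -> rat -> M -> M).
Hypothesis YM0r : forall u a, YM u a 0 = 0.
Hypothesis YM0l : forall a w, YM 0 a w = 0.
Variables (u v : V) (w : M).

(** The coefficient of z0^(-1-l) z1^(-1-m) z2^(-1-n) in the Jacobi identity is the Borcherds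
    identity; these are the terms of its three sums, up to the sign (-1)^l of the second one. *)
Definition term12 (l m n : rat) (i : nat) : M :=
  ratr ((-1) ^+ i * gbinom l i) *: YM u (m + l - i%:R) (YM v (n + i%:R) w).
Definition term21 (l m n : rat) (i : nat) : M :=
  ratr ((-1) ^+ i * gbinom l i) *: YM v (n + l - i%:R) (YM u (m + i%:R) w).
Definition term10 (l m n : rat) (i : nat) : M :=
  ratr (gbinom m i) *: YM (YV u (l + i%:R) v) (m + n - i%:R) w.

Lemma coef_delta_12 (l m n : rat) N :
  (forall i, (N <= i)%N -> YM v (n + i%:R) w = 0) ->
  series_mul delta_12 (fun x : expo => let: (a, b, c) := x in
    if a == 0 then YM u (-1 - b) (YM v (-1 - c) w) else 0)
    (-1 - l, -1 - m, -1 - n)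
  = if l \is a Num.int then \sum_(i < N) term12 l m n i else 0.
Proof.
move=> vN.
rewrite (@series_mulE _ _ _ _ _ (fun i => (-1 - l, l - i%:R, i%:R)) N) //.
- case: ifP => lint; last first.
    rewrite big1 // => i _; rewrite /delta_12 ifF ?rmorph0 ?scale0r //.
    by apply/negP => /(rpredB (rpredN1 _)); rewrite opprB addrC subrK lint.
  apply: eq_bigr => i _; rewrite expoB subrr eqxx /delta_12 ifT; last first.
    by rewrite rpredB // rpredN1.
  rewrite (@binom_coef_nat _ _ _ i) //; last by ring.
  rewrite /term12; congr (ratr (_ * gbinom _ _) *: YM u _ (YM v _ _)); ring.
- by move=> i j [_ /eqP]; rewrite eqr_nat => /eqP.
move=> [[a b] c] hp; rewrite expoB.
have [a_l|a_l] := eqVneq (-1 - l - a) 0; last by right.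
have [|] := eqVneq (delta_12 (a, b, c)) 0; first by left.
rewrite /delta_12; case: ifP => [aint|]; last by rewrite eqxx.
move=> /binom_coef_neq0[i [ci bi]]; right.
have al : a = -1 - l by apply/esym/eqP; rewrite -subr_eq0 a_l.
have -> : -1 - (-1 - n - c) = n + i%:R by rewrite ci; ring.
rewrite vN ?YM0r // leqNgt; apply/negP => iN; apply: (hp i iN).
by rewrite ci bi al; congr (_, _, _); ring.
Qed.

Lemma coef_delta_21 (l : int) (m n : rat) N :
  (forall i, (N <= i)%N -> YM u (m + i%:R) w = 0) ->
  series_mul delta_21 (fun x : expo => let: (a, b, c) := x in
    if a == 0 then YM v (-1 - c) (YM u (-1 - b) w) else 0)
    (-1 - l%:~R, -1 - m, -1 - n)
  = (-1) ^ l *: \sum_(i < N) term21 l%:~R m n i.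
Proof.
move=> uN.
rewrite (@series_mulE _ _ _ _ _ (fun i => (-1 - l%:~R, i%:R, l%:~R - i%:R)) N) //.
- rewrite scaler_sumr; apply: eq_bigr => i _; rewrite expoB subrr eqxx.
  rewrite /delta_21 ifT; last by rewrite rpredB ?rpredN1 ?intr_int.
  have -> : -1 - (-1 - l%:~R) = l%:~R :> rat by ring.
  rewrite intrKfloor (@binom_coef_nat _ _ _ i) // rmorphM /= /term21 scalerA.
  rewrite fmorphXz rmorphN1.
  congr (_ *: YM v _ (YM u _ _)); ring.
- by move=> i j [/eqP]; rewrite eqr_nat => /eqP.
move=> [[a b] c] hp; rewrite expoB.
have [a_l|a_l] := eqVneq (-1 - l%:~R - a) 0; last by right.
have [|] := eqVneq (delta_21 (a, b, c)) 0; first by left.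
rewrite /delta_21; case: ifP => [aint|]; last by rewrite eqxx.
rewrite mulf_eq0 negb_or => /andP[_ /binom_coef_neq0[i [bi ci]]]; right.
have al : a = -1 - l%:~R by apply/esym/eqP; rewrite -subr_eq0 a_l.
have -> : -1 - (-1 - m - b) = m + i%:R by rewrite bi; ring.
have -> : YM u (m + i%:R) w = 0; last exact: YM0r.
rewrite uN // leqNgt; apply/negP => iN; apply: (hp i iN).
by rewrite ci bi al; congr (_, _, _); ring.
Qed.

Lemma coef_delta_10 (s l m n : rat) N :
  (forall i, (N <= i)%N -> YV u (l + i%:R) v = 0) ->
  series_mul (delta_10 s) (fun x : expo => let: (a, b, c) := x in
    if b == 0 then YM (YV u (-1 - a) v) (-1 - c) w else 0)
    (-1 - l, -1 - m, -1 - n)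
  = if m + s \is a Num.int then \sum_(i < N) term10 l m n i else 0.
Proof.
move=> uvN.
rewrite (@series_mulE _ _ _ _ _ (fun i => (i%:R, -1 - m, m - i%:R)) N) //.
(* Along the ray the exponent of z2 moves by integers, so the integrality test in [delta_10] has the
   same outcome for all terms. *)
- have hint (i : nat) : (-1 - (m - i%:R) - s \is a Num.int) = (m + s \is a Num.int).
    have e1 : -1 - (m - i%:R) - s = i%:R - 1 - (m + s) by ring.
    have iint : (i%:R - 1 : rat) \is a Num.int by rewrite rpredB ?rpred_nat ?rpred1.
    rewrite e1; apply/idP/idP => h; last by rewrite rpredB.
    by rewrite -[m + s](subKr (i%:R - 1)) rpredB.
  case: ifP => mint; last first.
    rewrite big1 // => i _; rewrite /delta_10 ifF ?rmorph0 ?scale0r //.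
    by rewrite hint.
  apply: eq_bigr => i _; rewrite expoB subrr eqxx /delta_10 hint mint.
  rewrite (@binom_coef_nat _ _ _ i) //; last by ring.
  rewrite /term10; congr (ratr _ *: YM (YV u _ _) _ _); [|ring|ring].
  by rewrite -[RHS]gbinom_neg; congr (_ * gbinom _ _); ring.
- by move=> i j [/eqP]; rewrite eqr_nat => /eqP.
move=> [[a b] c] hp; rewrite expoB.
have [b_m|b_m] := eqVneq (-1 - m - b) 0; last by right.
have [|] := eqVneq (delta_10 s (a, b, c)) 0; first by left.
rewrite /delta_10; case: ifP => [aint|]; last by rewrite eqxx.
move=> /binom_coef_neq0[i [ai bi]]; right.
have bl : b = -1 - m by apply/esym/eqP; rewrite -subr_eq0 b_m.
have -> : -1 - (-1 - l - a) = l + i%:R by rewrite ai; ring.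
have -> : YV u (l + i%:R) v = 0; last exact: YM0l.
rewrite uvN // leqNgt; apply/negP => iN; apply: (hp i iN).
rewrite ai bl; congr (_, _, _); apply/eqP; rewrite -subr_eq0; apply/eqP.
have : b = -1 - c - i%:R by [].
rewrite bl => h; have := congr1 (fun x => -1 - m - x) h; rewrite /= subrr => ->; ring.
Qed.

Definition truncated (A : nmodType) (F : rat -> A) : Prop :=
  forall a, fsupp (fun i : nat => F (a + i%:R)).

Definition borcherds (l : int) (m n : rat) : Prop :=
  fsum (term12 l%:~R m n) - (-1) ^ l *: fsum (term21 l%:~R m n)
  = fsum (term10 l%:~R m n).

Hypotheses (tru : truncated (fun a => YM u a w))
  (trv : truncated (fun a => YM v a w)).

Lemma fsupp_term12 l m n : fsupp (term12 l m n).
Proof.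
apply: (fsupp_map (f := fun i x => ratr _ *: YM u _ x)) (trv n) => i.
by rewrite YM0r scaler0.
Qed.

Lemma fsupp_term21 l m n : fsupp (term21 l m n).
Proof.
apply: (fsupp_map (f := fun i x => ratr _ *: YM v _ x)) (tru m) => i.
by rewrite YM0r scaler0.
Qed.

Lemma fsupp_term10 l m n : fsupp (fun i : nat => YV u (l + i%:R) v) ->
  fsupp (term10 l m n).
Proof.
apply: (fsupp_map (f := fun i x => ratr _ *: YM x _ w)) => i.
by rewrite YM0l scaler0.
Qed.

Lemma jacobi_coefP (s : rat) (l : int) (m n : rat) :
  m + s \is a Num.int -> fsupp (fun i : nat => YV u (l%:~R + i%:R) v) ->
  series_mul delta_12 (fun x : expo => let: (a, b, c) := x in
      if a == 0 then YM u (-1 - b) (YM v (-1 - c) w) else 0)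
      (-1 - l%:~R, -1 - m, -1 - n)
  - series_mul delta_21 (fun x : expo => let: (a, b, c) := x in
      if a == 0 then YM v (-1 - c) (YM u (-1 - b) w) else 0)
      (-1 - l%:~R, -1 - m, -1 - n)
  = series_mul (delta_10 s) (fun x : expo => let: (a, b, c) := x in
      if b == 0 then YM (YV u (-1 - a) v) (-1 - c) w else 0)
      (-1 - l%:~R, -1 - m, -1 - n)
  <-> borcherds l m n.
Proof.
move=> mint truv; rewrite /borcherds.
have [N1 vN] := fsupp_natP (trv n); have [N2 uN] := fsupp_natP (tru m).
have [N3 uvN] := fsupp_natP truv.
rewrite (coef_delta_12 _ _ vN) (coef_delta_21 l n uN) (coef_delta_10 s m n uvN).
rewrite mint intr_int (@fsum_nat _ _ N1) ?(@fsum_nat _ (term21 _ _ _) N2) //.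
- by rewrite (@fsum_nat _ _ N3) // => i /uvN; rewrite /term10 => ->; rewrite YM0l scaler0.
- by move=> i /uN; rewrite /term21 => ->; rewrite YM0r scaler0.
- by move=> i /vN; rewrite /term12 => ->; rewrite YM0r scaler0.
Qed.

Lemma jacobi_borcherds (s : rat) (l : int) (m n : rat) :
  jacobi YV YM s u v w -> m + s \is a Num.int ->
  fsupp (fun i : nat => YV u (l%:~R + i%:R) v) -> borcherds l m n.
Proof. by move=> jac mint truv; apply/(jacobi_coefP n mint truv); apply: jac. Qed.

(** The other coefficients vanish on both sides: z0 occurs with integral exponents only, and the
    modes of [u] have indices in -s + Z. *)
Lemma borcherds_jacobi (s : rat) :
  (forall l : int, fsupp (fun i : nat => YV u (l%:~R + i%:R) v)) ->
  (forall a, a \isn't a Num.int -> YV u a v = 0) ->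
  (forall a x, a + s \isn't a Num.int -> YM u a x = 0) ->
  (forall (l : int) m n, m + s \is a Num.int -> borcherds l m n) ->
  jacobi YV YM s u v w.
Proof.
move=> truv uv0 u0 B; rewrite /jacobi; cbv zeta => -[[a b] c].
have -> : a = -1 - (-1 - a) by ring.
have -> : b = -1 - (-1 - b) by ring.
have -> : c = -1 - (-1 - c) by ring.
move: (-1 - a) (-1 - b) (-1 - c) => l m n {a b c}.
have [/intrP[l' ->]|lint] := boolP (l \is a Num.int); last first.
  rewrite /series_mul !fsbig1 ?subr0 //.
  - move=> [[a b] c] _; rewrite expoB.
    have [b_m|b_m] := eqVneq (-1 - m - b) 0; last by rewrite scaler0.
    have [|] := eqVneq (delta_10 s (a, b, c)) 0.
      by move=> ->; rewrite rmorph0 scale0r.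
    rewrite /delta_10; case: ifP => [_|]; last by rewrite eqxx.
    move=> /binom_coef_neq0[i [-> _]].
    rewrite uv0 ?YM0l ?scaler0 //; apply: contraNN lint => h.
    have -> : l = -1 - (-1 - l - i%:R) - i%:R by ring.
    by rewrite rpredB ?rpred_nat.
  - move=> [[a b] c] _; rewrite expoB.
    have [a_l|a_l] := eqVneq (-1 - l - a) 0; last by rewrite scaler0.
    rewrite /delta_21 ifF ?rmorph0 ?scale0r //.
    apply/negP => h; move: lint.
    have -> : l = -1 - a by apply/eqP; rewrite -subr_eq0 -oppr_eq0 -a_l; apply/eqP; ring.
    by rewrite rpredB ?rpredN1.
  - move=> [[a b] c] _; rewrite expoB.
    have [a_l|a_l] := eqVneq (-1 - l - a) 0; last by rewrite scaler0.
    rewrite /delta_12 ifF ?rmorph0 ?scale0r //.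
    apply/negP => h; move: lint.
    have -> : l = -1 - a by apply/eqP; rewrite -subr_eq0 -oppr_eq0 -a_l; apply/eqP; ring.
    by rewrite rpredB ?rpredN1.
have [mint|mint] := boolP (m + s \is a Num.int).
  by apply/(jacobi_coefP n mint (truv l')); exact: B.
have [N1 vN] := fsupp_natP (trv n); have [N2 uN] := fsupp_natP (tru m).
have [N3 uvN] := fsupp_natP (truv l').
rewrite (coef_delta_12 _ _ vN) (coef_delta_21 l' n uN) (coef_delta_10 s m n uvN).
have u0' (k : int) x : YM u (m + k%:~R) x = 0.
  apply: u0; apply: contraNN mint => h.
  by rewrite -[m](addrK k%:~R) addrAC rpredB ?intr_int.
rewrite (negbTE mint) intr_int !big1 ?scaler0 ?subr0 // => i _.
  by rewrite /term21 (u0' i%:Z) YM0r scaler0.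
by rewrite /term12 -addrA -(intrB _ _ i%:Z) u0' scaler0.
Qed.

End JacobiCoefficients.

(** * Binomial identities *)

(** Summation along antidiagonals. Vanishing outside a box bounds the rows uniformly, so that no sum
    falls under the convention that infinite support gives 0. *)
Lemma fsum_triangle (A : nmodType) (H : nat -> nat -> A) (J Q : nat) :
  (forall j i, (J <= j)%N || (Q <= i)%N -> H j i = 0) ->
  fsum (fun n => \sum_(j < n.+1) H j (n - j)%N) = fsum (fun j => fsum (H j)).
Proof.
move=> H0; pose N := (J + Q)%N.
rewrite (@fsum_nat _ _ N); last first.
  by move=> n nN; rewrite big1 // => j _; apply: H0; have := ltn_ord j; lia.
rewrite (@fsum_nat _ (fun j => fsum _) N); last first.
  move=> j jN; rewrite fsbig1 // => i _; apply: H0; lia.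
transitivity (\sum_(n < N) \sum_(j < N | (j <= n)%N) H j (n - j)%N).
  apply: eq_bigr => n _.
  by rewrite (big_ord_widen N (fun j => H j (n - j)%N)) //.
rewrite (exchange_big_dep xpredT) //=; apply: eq_bigr => j _.
rewrite (@fsum_nat _ _ (N - j)); last by move=> i iN; apply: H0; lia.
rewrite -(@big_geq_mkord _ _ _ j N xpredT (fun n => H j (n - j)%N)).
rewrite -(big_mkord xpredT (H j)) -{1}(add0n (j : nat)) big_addn.
by apply: eq_bigr => i _; rewrite addnK.
Qed.

Lemma gbinom0 s : gbinom s 0 = 1.
Proof. by rewrite /gbinom big_ord0 fact0 divr1. Qed.

Lemma gbinomS s i : i.+1%:R * gbinom s i.+1 = (s - i%:R) * gbinom s i.
Proof.
rewrite /gbinom big_ord_recr /= factS natrM.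
have h1 : (i.+1%:R : rat) != 0 by rewrite pnatr_eq0.
have h2 : (i`!%:R : rat) != 0 by rewrite pnatr_eq0 -lt0n fact_gt0.
by field; rewrite h2 addrC natr1 h1.
Qed.

Lemma gbinom1 s : gbinom s 1 = s.
Proof. by have := gbinomS s 0; rewrite gbinom0 mul1r mulr1 subr0. Qed.

Lemma gbinom_pascal s i : gbinom (s + 1) i.+1 = gbinom s i.+1 + gbinom s i.
Proof.
elim: i => [|i IH]; first by rewrite !gbinom1 gbinom0.
have h : (i.+2%:R : rat) != 0 by rewrite pnatr_eq0.
apply: (mulfI h); rewrite mulrDr !gbinomS IH.
have e := gbinomS s i; rewrite -!natr1 in e *.
rewrite mulrDr [X in _ = _ + X]mulrC.
have -> : (s + 1 - (i%:R + 1)) = s - i%:R by ring.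
by rewrite -e; ring.
Qed.

Lemma gbinomSV s i : i.+1%:R * gbinom s i.+1 = s * gbinom (s - 1) i.
Proof.
elim: i s => [|i IH] s; first by rewrite gbinom1 gbinom0; ring.
have h : (i.+1%:R : rat) != 0 by rewrite pnatr_eq0.
apply: (mulfI h); rewrite gbinomS mulrCA IH mulrA [RHS]mulrCA gbinomS.
by rewrite -natr1; ring.
Qed.

Lemma gbinom_vandermonde s t q :
  \sum_(i < q.+1) gbinom s i * gbinom t (q - i) = gbinom (s + t) q.
Proof.
elim: q => [|q IH]; first by rewrite big_ord1 !gbinom0 mulr1.
have h : (q.+1%:R : rat) != 0 by rewrite pnatr_eq0.
apply: (mulfI h); rewrite gbinomS -IH !mulr_sumr.
(* Writing q + 1 = i + (q + 1 - i) is Leibniz' rule for (1 + y)^s (1 + y)^t. *)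
transitivity (\sum_(i < q.+2) i%:R * gbinom s i * gbinom t (q.+1 - i)
  + \sum_(i < q.+2) gbinom s i * ((q.+1 - i)%:R * gbinom t (q.+1 - i))).
  rewrite -big_split; apply: eq_bigr => i _ /=.
  have : (i <= q.+1)%N by rewrite -ltnS.
  by move=> /subnK {1}<-; rewrite natrD; ring.
rewrite big_ord_recl [X in _ + X = _]big_ord_recr /= subnn !mul0r mulr0 add0r addr0.
rewrite -big_split; apply: eq_bigr => i _ /=.
rewrite /bump add1n gbinomS subSS subSn -1?ltnS // gbinomS natrB -1?ltnS //.
by ring.
Qed.

(* Coefficients of (1 + y) log(1 + y) = \sum_n ecoef n y^(n + 1). *)
Definition ecoef (n : nat) : rat :=
  if n is n'.+1 then (-1) ^+ n' / (n'.+1%:R * n'.+2%:R) else 1.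

Arguments ecoef : simpl never.

Lemma ecoefS n : (0 < n)%N -> n.+2%:R * ecoef n.+1 = - n%:R * ecoef n.
Proof.
case: n => // n _; rewrite /ecoef exprS.
have h1 : (n.+1%:R : rat) != 0 by rewrite pnatr_eq0.
have h2 : (n.+2%:R : rat) != 0 by rewrite pnatr_eq0.
have h3 : (n.+3%:R : rat) != 0 by rewrite pnatr_eq0.
by field; rewrite ?h1 ?h2 ?h3 -?natr1 //; apply/and3P; split; rewrite ?natr1 // -?natrD ?pnatr_eq0.
Qed.

Lemma ecoef1 : 2 * ecoef 1 = 1.
Proof. by rewrite /ecoef expr0; field. Qed.

(** For f = (1 + y) log(1 + y), both sides are the coefficient of y^i in f^(j+1)/(j+1)! = e_j (1 +
    y)^(-j), which holds from f'' = 1/(1 + y) on, that is for j > 0. *)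
Lemma ecoef_gbinom j i : (0 < j)%N ->
  ecoef (j + i) * gbinom (j + i).+1%:R j.+1 = ecoef j * gbinom (- j%:R) i.
Proof.
move=> j0; elim: i => [|i IH].
  rewrite addn0 gbinom0; congr (_ * _); elim: (j.+1) => [|p IH]; first by rewrite gbinom0.
  have h : (p.+1%:R : rat) != 0 by rewrite pnatr_eq0.
  apply: (mulfI h); rewrite gbinomSV -[p.+1%:R - 1]/(p.+1%:R - 1%:R) -natrB // subn1 /= IH //.
have h1 : (i.+1%:R : rat) != 0 by rewrite pnatr_eq0.
have h2 : ((j + i).+2%:R : rat) != 0 by rewrite pnatr_eq0.
have E1 := @ecoefS (j + i) (ltn_addr _ j0).
have P1 : i.+1%:R * gbinom (j + i).+2%:R j.+1 = (j + i).+2%:R * gbinom (j + i).+1%:R j.+1.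
  have e1 := gbinomSV (j + i).+2%:R j.
  have e2 := gbinomS (j + i).+1%:R j.
  have e3 : (j + i).+2%:R - 1 = (j + i).+1%:R :> rat by rewrite -natr1 addrK.
  have e4 : (j + i).+1%:R - j%:R = i.+1%:R :> rat by rewrite -natrB -?addnS ?leq_addr // addKn.
  rewrite e3 in e1; rewrite e4 in e2.
  have hj : (j.+1%:R : rat) != 0 by rewrite pnatr_eq0.
  by apply: (mulfI hj); rewrite mulrCA e1 mulrCA -e2; ring.
rewrite addnS; apply: (mulfI h1); apply: (mulfI h2).
rewrite [i.+1%:R * (ecoef j * _)]mulrCA gbinomS.
rewrite [i.+1%:R * (_ * _)]mulrCA P1.
transitivity ((j + i).+2%:R * ((j + i).+2%:R * ecoef (j + i).+1) * gbinom (j + i).+1%:R j.+1).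
  by ring.
rewrite E1 natrD; transitivity ((j + i).+2%:R * (- (j%:R + i%:R)) * (ecoef (j + i) * gbinom (j + i).+1%:R j.+1)).
  by ring.
by rewrite IH; ring.
Qed.

(** The coefficient of y^q in s f' (1 + y)^s - f ((1 + y)^s)' = s (1 + y)^s, where f = (1 + y) log(1
    + y) satisfies (1 + y) f' - f = 1 + y. *)
Lemma ecoef_sum s q :
  \sum_(n < q.+1) ecoef n * gbinom s (q - n) * (n.+1%:R * s - (q - n)%:R)
  = s * gbinom s q.
Proof.
case: q => [|q].
  rewrite big_ord1 /= subn0 !gbinom0 /ecoef. ring.
pose a i := gbinom (s - 1) i.
transitivity (s * (\sum_(n < q.+2) n.+1%:R * ecoef n * a (q.+1 - n)%N
   + \sum_(n < q.+1) n%:R * ecoef n * a (q - n)%N)).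
  rewrite mulrDr !mulr_sumr [LHS]big_ord_recr [X in _ = X + _]big_ord_recr /=.
  rewrite subnn /a !gbinom0 -addrA [X in _ = _ + X]addrC addrA -big_split /=.
  congr (_ + _); last by ring.
  apply: eq_bigr => n _; rewrite subSn -1?ltnS //.
  have e := gbinom_pascal (s - 1) (q - n); rewrite subrK in e.
  have e2 := gbinomSV s (q - n).
  transitivity (ecoef n * (n.+1%:R * s * gbinom s (q - n).+1 - (q - n).+1%:R * gbinom s (q - n).+1)).
    by ring.
  by rewrite e2 e -natr1; ring.
(* The sum is a coefficient of (1 + y)^(s-1) ((1 + y) f' - f). By [ecoefS] only the coefficients of
   1 and y in the second factor survive, and Pascal's rule combines them. *)
congr (_ * _); rewrite big_ord_recl -addrA -big_split big_ord_recl /= big1.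
  rewrite /bump /= subn0 subSS subn0 addr0 ecoef1 -[X in gbinom X q.+1](subrK 1 s).
  by rewrite gbinom_pascal /a /ecoef; ring.
move=> n _; rewrite /bump /= !add1n subSS -mulrDl (@ecoefS n.+1) //; ring.
Qed.

Lemma fsum_recl (A : nmodType) (F : nat -> A) : fsupp F ->
  fsum F = F 0%N + fsum (fun n => F n.+1).
Proof.
move=> /fsupp_natP[N FN].
rewrite (@fsum_nat _ F N.+1); last by move=> i /ltnW; exact: FN.
by rewrite (@fsum_nat _ (fun n => F n.+1) N) ?big_ord_recl // => i /leqW /FN.
Qed.

Lemma fsum_exchange (A : nmodType) (F : nat -> nat -> A) (J Q : nat) :
  (forall j i, (J <= j)%N || (Q <= i)%N -> F j i = 0) ->
  fsum (fun j => fsum (F j)) = fsum (fun i => fsum (F^~ i)).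
Proof.
move=> F0.
rewrite (@fsum_nat _ _ J); last first.
  by move=> j jJ; rewrite fsbig1 // => i _; apply: F0; rewrite jJ.
rewrite (@fsum_nat _ (fun i => fsum (F^~ i)) Q); last first.
  by move=> i iQ; rewrite fsbig1 // => j _; apply: F0; rewrite iQ orbT.
under eq_bigr => j _.
  rewrite (@fsum_nat _ _ Q); last by move=> i iQ; apply: F0; rewrite iQ orbT.
  over.
rewrite exchange_big /=; apply: eq_bigr => i _.
by rewrite (@fsum_nat _ _ J) // => j jJ; apply: F0; rewrite jJ.
Qed.

Lemma fsum_convolution (K : numFieldType) (A : lmodType K) (a c : nat -> rat)
    (X : nat -> A) : fsupp X ->
  fsum (fun i => ratr (a i) *: fsum (fun n => ratr (c n) *: X (i + n)%N))
  = fsum (fun q => ratr (\sum_(n < q.+1) a n * c (q - n)%N) *: X q).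
Proof.
move=> /fsupp_natP[N XN].
pose H (j i : nat) := (ratr (a j) * ratr (c i)) *: X (j + i)%N : A.
transitivity (fsum (fun i => fsum (H i))).
  apply: eq_fsum => i; rewrite (fsum_map (f := *:%R (ratr (a i)))) ?scaler0 //.
  - by apply: eq_fsum => n; rewrite scalerA.
  - by move=> ? ?; rewrite scalerDr.
  - by apply: (@fsupp_nat _ _ N) => n nN; rewrite XN ?scaler0 //; lia.
rewrite -(@fsum_triangle _ _ N N); last first.
  by move=> j i ji; rewrite /H XN ?scaler0 //; lia.
apply: eq_fsum => q; rewrite rmorph_sum scaler_suml; apply: eq_bigr => n _.
by rewrite /H rmorphM /= subnKC // -ltnS.
Qed.

Lemma gbinom_nat_small (n i : nat) : (n < i)%N -> gbinom n%:R i = 0.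
Proof.
move=> ni; rewrite /gbinom (bigD1 (Ordinal ni)) //= subrr mul0r mul0r //.
Qed.

Lemma gbinom_m2 i : (-1) ^+ i * gbinom (-2) i = i.+1%:R.
Proof.
elim: i => [|i IH]; first by rewrite expr0 gbinom0 mul1r.
have h : (i.+1%:R : rat) != 0 by rewrite pnatr_eq0.
apply: (mulfI h); rewrite mulrCA gbinomS exprS.
transitivity ((2 + i%:R) * ((-1) ^+ i * gbinom (-2) i)); first by ring.
by rewrite IH -[i.+2%:R]natr1 -[i.+1%:R]natr1; ring.
Qed.

(** * Borcherds identities in a vertex algebra *)

Section VertexAlgebra.
Variables (R : realType) (V : vertexAlgebra R).
Local Notation K := R[i].
Local Notation Y := (@va_mode R V).

Lemma mode_ratE (u : V) (n : int) v : mode_rat Y u n%:~R v = Y u n v.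
Proof. by rewrite /mode_rat intr_int intrKfloor. Qed.

Lemma Y0l n v : Y 0 n v = 0. Proof. exact: lin0 (va_linearl n v). Qed.
Lemma Y0r u n : Y u n 0 = 0. Proof. exact: lin0 (va_linearr u n). Qed.

Lemma fsupp_Y (u v : V) (a : int) : fsupp (fun i : nat => Y u (a + i%:Z) v).
Proof.
have [N uN] := va_trunc u v.
apply: (@fsupp_nat _ _ `|N - a|%N) => i hi; apply: uN; lia.
Qed.

Lemma truncated_mode_rat (u v : V) : truncated (fun a => mode_rat Y u a v).
Proof.
move=> a; have [/intrP[n ->]|aint] := boolP (a \is a Num.int).
  have [r hr] := fsupp_Y u v n; exists r => i /hr <-.
  by rewrite -mode_ratE intrD.
exists [::] => i _; rewrite /mode_rat ifF //; apply/negP => h.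
by move: aint; rewrite -[a](addrK i%:R) rpredB ?rpred_nat.
Qed.

Lemma va_borcherds (u v w : V) (l m n : int) :
  fsum (fun i => ratr ((-1) ^+ i * gbinom l%:~R i) *:
          Y u (m + l - i%:Z) (Y v (n + i%:Z) w) : V)
  - (-1) ^ l *: fsum (fun i => ratr ((-1) ^+ i * gbinom l%:~R i) *:
          Y v (n + l - i%:Z) (Y u (m + i%:Z) w) : V)
  = fsum (fun i => ratr (gbinom m%:~R i) *: Y (Y u (l + i%:Z) v) (m + n - i%:Z) w : V).
Proof.
have M0r (x : V) a : mode_rat Y x a 0 = 0 by rewrite /mode_rat Y0r if_same.
have M0l a (x : V) : mode_rat Y 0 a x = 0 by rewrite /mode_rat Y0l if_same.
have := @jacobi_borcherds K V V (mode_rat Y) (mode_rat Y) M0r M0l u v w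
  (truncated_mode_rat u w) (truncated_mode_rat v w) 0 l m%:~R n%:~R
  (va_jacobi u v w).
rewrite addr0 intr_int => /(_ isT (truncated_mode_rat u v _)).
rewrite /borcherds /term12 /term21 /term10.
have e (a : int) (i : nat) : a%:~R + i%:R = (a + i%:Z)%:~R :> rat by rewrite intrD.
have e' (a : int) (i : nat) : a%:~R - i%:R = (a - i%:Z)%:~R :> rat by rewrite intrB.
move=> h; apply: etrans (etrans _ h) _; last first.
  by apply: eq_fsum => i; rewrite -intrD e e' !mode_ratE.
by congr (_ - _ *: _); apply: eq_fsum => i; rewrite -intrD e e' !mode_ratE.
Qed.

Lemma va_commutator (u v w : V) (m n : int) :
  Y u m (Y v n w) - Y v n (Y u m w)
  = fsum (fun i => ratr (gbinom m%:~R i) *: Y (Y u i%:Z v) (m + n - i%:Z) w : V).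
Proof.
have := va_borcherds u v w 0 m n.
have g0 i : (0 < i)%N -> gbinom 0%:~R i = 0 by exact: (@gbinom_nat_small 0).
rewrite [X in X - _ = _](@fsum1 _ _ _ 0%N); last first.
  by case=> // i _; rewrite g0 // mulr0 rmorph0 scale0r.
rewrite [X in _ - _ *: X = _](@fsum1 _ _ _ 0%N); last first.
  by case=> // i _; rewrite g0 // mulr0 rmorph0 scale0r.
rewrite -![Posz 0]/(0 : int) gbinom0 expr0 mulr1 rmorph1 !scale1r !addr0 ?subr0 => ->.
by apply: eq_fsum => i; rewrite add0r.
Qed.

(** The Borcherds identity with [v] the vacuum, l = -2 and m = 0. The vacuum has the single mode -1,
    so at most one term survives on the left: in the first sum for n < 0, in the second for n >
    0. *)
Lemma va_mode_D (u w : V) (n : int) :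
  Y (va_D u) n w = (- n%:~R) *: Y u (n - 1) w.
Proof.
have := va_borcherds u (va_vac V) w (-2) 0 n.
have g0 i : (0 < i)%N -> gbinom 0%:~R i = 0 by exact: (@gbinom_nat_small 0).
rewrite [RHS](@fsum1 _ _ _ 0%N); last first.
  by case=> // i _; rewrite g0 // rmorph0 scale0r.
rewrite gbinom0 rmorph1 scale1r => h.
have -> : Y (va_D u) n w = Y (Y u (-2 + 0%N%:Z) (va_vac V)) (0 + n - 0%N%:Z) w.
  by rewrite /va_D; congr (Y (Y u _ _) _ w); lia.
rewrite -h {h}.
rewrite (_ : (-1) ^ (-2) = 1 :> K) ?scale1r; last by rewrite -exprnN expr2 mulrNN mulr1 invr1.
have c (i : nat) : ratr ((-1) ^+ i * gbinom (-2)%:~R i) = i.+1%:R :> K.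
  by rewrite gbinom_m2 ratr_nat.
have [n0|n0] := ltrP n 0; last first.
  rewrite [X in X - _](fsbig1 _) ?sub0r; last first.
    by move=> i _; rewrite va_vacl ifF ?Y0r ?scaler0 //; lia.
  have [->|n1] := eqVneq n 0.
    rewrite fsbig1 ?oppr0 ?scale0r // => i _.
    by rewrite va_vacl ifF ?scaler0 //; lia.
  rewrite (@fsum1 _ _ _ `|n - 1|%N); last first.
    by move=> i hi; rewrite va_vacl ifF ?scaler0 //; lia.
  rewrite c va_vacl ifT; last lia.
  rewrite -scaleNr; congr (_ *: Y u _ w); last lia.
  by congr (- _); rewrite -[LHS]/((`|n - 1|.+1)%:Z%:~R); congr (_%:~R); lia.
rewrite [X in _ - X](fsbig1 _) ?subr0; last first.
  by move=> i _; rewrite va_vacl ifF ?scaler0 //; lia.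
rewrite (@fsum1 _ _ _ `|(n + 1)%R|%N); last first.
  by move=> i hi; rewrite va_vacl ifF ?Y0r ?scaler0 //; lia.
rewrite c va_vacl ifT; last lia.
congr (_ *: Y u _ w); last lia.
rewrite -[LHS]/((`|(n + 1)%R|.+1)%:Z%:~R) -mulrNz; congr (_%:~R); lia.
Qed.

End VertexAlgebra.

(** * The grading by conformal weight *)

Section Grading.
Variables (R : realType) (V : vertexAlgebra R) (w : V).
Hypothesis hw : is_voa w.
Local Notation K := R[i].
Local Notation Y := (@va_mode R V).
Local Notation L := (vir w).

Definition wt (k : int) (v : V) : Prop := L 0 v = k%:~R *: v.

Lemma wt0 k : wt k 0.
Proof. by rewrite /wt /vir Y0r scaler0. Qed.

Lemma wtD k u v : wt k u -> wt k v -> wt k (u + v).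
Proof.
by rewrite /wt /vir (linD (va_linearr _ _)) scalerDr => -> ->.
Qed.

Lemma wtZ k a v : wt k v -> wt k (a *: v).
Proof.
rewrite /wt /vir (linZ (va_linearr _ _)) => ->.
by rewrite !scalerA mulrC.
Qed.

Let ds := conf_L0_semisimple (voa_conformal hw).

Definition wproj (k : int) (v : V) : V := ds_proj ds k%:~R v.

Lemma wproj_wt k v : wt k (wproj k v).
Proof. exact: (ds_proj_in ds k%:~R v). Qed.

Lemma wproj_linear k : linear (wproj k).
Proof. exact: ds_proj_linear. Qed.

Lemma wproj_id j k v : wt k v -> wproj j v = if j == k then v else 0.
Proof.
by move=> hv; rewrite /wproj (@ds_proj_id _ _ _ _ ds k%:~R) // eqr_int.
Qed.

Lemma wproj_supp v : fsupp (wproj^~ v).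
Proof.
have [r hr] := ds_proj_supp ds v.
(* [f] inverts the embedding of the integers, turning the finite list of complex eigenvalues into a
   list of weights. *)
pose f (z : K) : int := xget 0 [set k : int | k%:~R = z].
exists (map f r) => k; apply: contraNeq => hk.
have kr : (k%:~R : K) \in r.
  by apply: contraNT hk => /hr h; rewrite /wproj h.
apply/mapP; exists k%:~R => //; rewrite /f.
case: xgetP => [j _ /= /eqP|/(_ k)]; last by case.
by rewrite eqr_int => /eqP.
Qed.

Lemma wproj_sum v : v = fsum (wproj^~ v).
Proof.
rewrite {1}(ds_proj_sum ds v).
rewrite -(fsbig_widen (range (fun k : int => k%:~R : K)) setT) //; last first.
  move=> z [_ hz] /=; have := ds_proj_in ds z v; rewrite (voa_int hw) //.
  by move=> k; apply/eqP => zk; apply: hz; exists k.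
by rewrite fsbig_image // => j k _ _ /= /eqP; rewrite eqr_int => /eqP.
Qed.

Lemma wt_ind (Q : V -> Prop) : Q 0 -> (forall x y, Q x -> Q y -> Q (x + y)) ->
  (forall k v, wt k v -> Q v) -> forall v, Q v.
Proof.
move=> Q0 QD Qh v; rewrite (wproj_sum v); apply: fsum_ind => // k.
exact/Qh/wproj_wt.
Qed.

Lemma wt_eq0 v : (forall k, wproj k v = 0) -> v = 0.
Proof. by move=> h; rewrite (wproj_sum v) fsbig1. Qed.

Lemma wt_bounded : exists B : int, forall k v, k <= B -> wt k v -> v = 0.
Proof.
have [B hB] := voa_bounded hw; exists B => k v kB hv.
by have : wt_space w k%:~R v by []; rewrite hB.
Qed.

Lemma L_linear n : linear (L n). Proof. exact: va_linearr. Qed.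

(** [L(0), L(n)] = -n L(n), as the central term carries the factor 0^3 - 0. *)
Lemma wt_L k n v : wt k v -> wt (k - n) (L n v).
Proof.
move=> hv; have [c hc] := conf_virasoro (voa_conformal hw).
have := hc 0 n v; rewrite !add0r hv (linZ (L_linear n)).
have -> : ((if n == 0 then (0 ^+ 3 - 0 : int)%:~R / 12%:R else 0) * c : K) = 0.
  by case: ifP; rewrite ?mul0r // expr0n subr0 mul0r mul0r.
rewrite scale0r addr0 => /eqP; rewrite subr_eq => /eqP h.
by rewrite /wt h -scalerDl -intrD addrC.
Qed.

Lemma w0_D u : Y w 0 u = va_D u.
Proof. by have := conf_D (voa_conformal hw) u; rewrite /vir addNr. Qed.

(** The commutator of L(0) = w_1 with u_n has two terms: w_0 u = D u contributes -n - 1 and w_1 u =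
    k u contributes k. *)
Lemma wt_mode k p n u v : wt k u -> wt p v -> wt (k + p - n - 1) (Y u n v).
Proof.
move=> hu hv; have := va_commutator w u v 1 n.
rewrite (@fsum_nat _ _ 2); last first.
  by move=> i i2; rewrite (@gbinom_nat_small 1) // rmorph0 scale0r.
rewrite !big_ord_recl big_ord0 /= /bump /= addr0 gbinom0 gbinom1 rmorph1 !scale1r.
rewrite w0_D va_mode_D.
have -> : Y w 1 u = k%:~R *: u by rewrite -hu.
rewrite (linZ (va_linearl _ _)).
have -> : Y w 1 v = p%:~R *: v by rewrite -hv.
rewrite (linZ (va_linearr _ _)) => /eqP; rewrite subr_eq => /eqP h.
rewrite /wt /vir add0r h.
have -> : 1 + n - 1 = n by lia.
rewrite addr0 -!scalerDl; congr (_ *: _).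
by rewrite -mulrNz -!intrD; congr (_%:~R); lia.
Qed.

End Grading.

(** * Linear extension of maps that depend on the weight *)

Section Extension.
Variables (R : realType) (V : vertexAlgebra R) (w : V).
Hypothesis hw : is_voa w.
Variables (A : lmodType R[i]) (F : int -> V -> A).
Hypothesis FL : forall k, linear (F k).

Definition wext (v : V) : A := fsum (fun k => F k (wproj hw k v)).

Lemma fsupp_wext v : fsupp (fun k => F k (wproj hw k v)).
Proof.
exact: (fsupp_map (f := F)) (fun k => lin0 (FL k)) (wproj_supp hw v).
Qed.

Lemma wext_linear : linear wext.
Proof.
apply: (@fsum_linear _ _ _ _ (fun k v => F k (wproj hw k v))) fsupp_wext.
by move=> k a x y; rewrite (wproj_linear hw k) FL.
Qed.

Lemma wext_id k v : wt w k v -> wext v = F k v.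
Proof.
move=> hv; rewrite /wext (@fsum1 _ _ _ k) => [|j jk].
  by rewrite (wproj_id hw _ hv) eqxx.
by rewrite (wproj_id hw _ hv) (negbTE jk) (lin0 (FL j)).
Qed.
End Extension.

Lemma wt_linear_eq (R : realType) (V : vertexAlgebra R) (w : V) (hw : is_voa w)
    (A : lmodType R[i]) (f g : V -> A) : linear f -> linear g ->
  (forall k v, wt w k v -> f v = g v) -> f =1 g.
Proof.
move=> fL gL fg; apply: (wt_ind hw); first by rewrite (lin0 fL) (lin0 gL).
  by move=> x y; rewrite (linD fL) (linD gL) => -> ->.
exact: fg.
Qed.

(** * Vertex operators on the cylinder *)

Lemma scale_linear (K : comPzRingType) (A B : lmodType K) (a : K) (f : A -> B) :
  linear f -> linear (fun x => a *: f x).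
Proof. by move=> fL b x y; rewrite fL scalerDr !scalerA mulrC. Qed.

Section Cylinder.
Variables (R : realType) (V : vertexAlgebra R) (w : V).
Hypothesis hw : is_voa w.
Local Notation K := R[i].
Local Notation Y := (@va_mode R V).
Local Notation L := (vir w).

Definition eop (v : V) : V := fsum (fun n : nat => ratr (ecoef n) *: L n%:Z v).

Lemma fsupp_L v : fsupp (fun n : nat => L n%:Z v).
Proof.
have [N hN] := fsupp_natP (fsupp_Y w v 1).
by apply: (@fsupp_nat _ _ N) => i /hN; rewrite /vir addrC.
Qed.

Lemma fsupp_scale (I : choiceType) (A : lmodType K) (a : I -> K) (F : I -> A) :
  fsupp F -> fsupp (fun i => a i *: F i).
Proof. by move=> [r hr]; exists r => i /hr ->; rewrite scaler0. Qed.

Lemma eop_linear : linear eop.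
Proof.
apply: (@fsum_linear _ _ _ _ (fun (n : nat) v => ratr (ecoef n) *: L n%:Z v)).
  by move=> n; apply/scale_linear/L_linear.
by move=> v; apply/fsupp_scale/fsupp_L.
Qed.

(* Res_y y^l (1 + y)^(m + k - 1) Y(u, y)v, the product C_(l,m)(u, v) in the
   coordinate y = e^x - 1, for u of weight k. *)
Definition cylk (k l : int) (m : rat) (u v : V) : V :=
  fsum (fun i : nat => ratr (gbinom (m + k%:~R - 1) i) *: Y u (l + i%:Z) v).

Lemma fsupp_cylk k l m u v :
  fsupp (fun i : nat => ratr (gbinom (m + k%:~R - 1) i) *: Y u (l + i%:Z) v).
Proof. exact/fsupp_scale/fsupp_Y. Qed.

Lemma cylk_linearl k l m v : linear (fun u => cylk k l m u v).
Proof.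
apply: (@fsum_linear _ _ _ _ (fun (i : nat) u => _ *: Y u (l + i%:Z) v)).
  by move=> n; apply/scale_linear/va_linearl.
by move=> u; exact: fsupp_cylk.
Qed.

Lemma cylk_linearr k l m u : linear (cylk k l m u).
Proof.
apply: (@fsum_linear _ _ _ _ (fun (i : nat) v => _ *: Y u (l + i%:Z) v)).
  by move=> n; apply/scale_linear/va_linearr.
by move=> v; exact: fsupp_cylk.
Qed.

Definition cyl (l : int) (m : rat) (u v : V) : V :=
  wext hw (fun k u => cylk k l m u v) u.

Lemma cyl_linearl l m v : linear (fun u => cyl l m u v).
Proof. exact: (wext_linear hw (fun k => cylk_linearl k l m v)). Qed.

Lemma cyl_linearr l m u : linear (cyl l m u).
Proof.
apply: (@fsum_linear _ _ _ _ (fun k v => cylk k l m (wproj hw k u) v)).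
  by move=> k; exact: cylk_linearr.
move=> v; exact: (fsupp_wext hw (fun k => cylk_linearl k l m v)).
Qed.

Lemma cyl_wt k l m u v : wt w k u -> cyl l m u v = cylk k l m u v.
Proof.
exact: (wext_id hw (fun k => cylk_linearl k l m v)).
Qed.

Lemma fsupp_cyl l m u v : fsupp (fun i : nat => cyl (l + i%:Z) m u v).
Proof.
move: u; apply: (wt_ind hw).
- by exists [::] => i _; rewrite (lin0 (cyl_linearl _ _ _)).
- move=> x y hx hy; have [r hr] := fsuppD hx hy.
  by exists r => i /hr; rewrite (linD (cyl_linearl _ _ _)).
move=> k u hu; have [N hN] := fsupp_natP (fsupp_Y u v l).
apply: (@fsupp_nat _ _ N) => i iN; rewrite (cyl_wt _ _ _ hu) /cylk fsbig1 // => j _.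
by rewrite -[l + _ + _]addrA -PoszD hN ?scaler0 // (leq_trans iN) // leq_addr.
Qed.

(** In the commutator formula the terms 0 and 1 make up the first summand, through w_0 u = D u and
    w_1 u = k u. The index [j] counts from term 2 on, where [u] is hit by a positive L(j + 1). *)
Lemma L_mode_comm k (n : nat) (u : V) (s : int) v : wt w k u ->
  L n%:Z (Y u s v) - Y u s (L n%:Z v)
  = ratr (n.+1%:R * k%:~R - (n.+1%:R + s%:~R)) *: Y u (s + n%:Z) v
  + \sum_(j < n) ratr (gbinom n.+1%:R j.+2) *: Y (L j.+1%:Z u) (s + (n - j.+1)%N%:Z) v.
Proof.
move=> hu; rewrite /vir va_commutator (@fsum_nat _ _ n.+2); last first.
  move=> i ni; rewrite -[(n%:Z + 1)%:~R]/((n%:Z + 1%:Z)%:~R) -PoszD addn1.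
  by rewrite gbinom_nat_small // rmorph0 scale0r.
rewrite !big_ord_recl /= addrA; congr (_ + _).
  rewrite /bump /= gbinom0 gbinom1 rmorph1 scale1r (w0_D hw) va_mode_D.
  have -> : Y w 1 u = k%:~R *: u by rewrite -hu.
  rewrite (linZ (va_linearl _ _)) scalerA.
  have -> : n%:Z + 1 + s - 0%N%:Z - 1 = s + n%:Z by lia.
  have -> : n%:Z + 1 + s - (1 + 0)%N%:Z = s + n%:Z by lia.
  rewrite -scalerDl; congr (_ *: _).
  by rewrite -!natr1 !(rmorphB, rmorphM, rmorphD, rmorphN) /= !ratr_int; ring.
apply: eq_bigr => j _; rewrite /bump /= !add1n.
congr (ratr (gbinom _ _) *: Y (Y w _ u) _ v); [by rewrite intrD natr1 |lia|].
by have := ltn_ord j; lia.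
Qed.

(** All but finitely many L(j + 1) u vanish, so the truncation orders of the others have a
    maximum. *)
Lemma mode_L_bounded (u v : V) (s : int) : exists J Q, forall j i : nat,
  (J <= j)%N || (Q <= i)%N -> Y (L j.+1%:Z u) (s + i%:Z) v = 0.
Proof.
have [J hJ] := fsupp_natP (fsupp_L u).
have hQ j := fsupp_natP (fsupp_Y (L j%:Z u) v s).
have [Q {}hQ] := choice hQ.
exists J, (\max_(j < J) Q j.+1) => j i.
have [jJ|jJ] := leqP J j; first by rewrite hJ ?Y0l // leqW.
move=> /= iQ; apply: hQ; apply: leq_trans iQ.
exact: (leq_bigmax (F := fun j : 'I_J => Q j.+1) (Ordinal jJ)).
Qed.

(** Weighting the commutators by e_n collects Taylor coefficients of (1 + y) log(1 + y). From the
    second derivative on these are multiples of (1 + y)^(-j-1), by [ecoef_gbinom]. *)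
Lemma eop_mode_comm k (u v : V) (s : int) : wt w k u ->
  eop (Y u s v) - Y u s (eop v)
  = fsum (fun n : nat =>
      ratr (ecoef n * (n.+1%:R * k%:~R - (n.+1%:R + s%:~R))) *: Y u (s + n%:Z) v)
  + fsum (fun j : nat => ratr (ecoef j.+1) *:
      fsum (fun i : nat => ratr (gbinom (- j.+1%:R) i) *: Y (L j.+1%:Z u) (s + i%:Z) v)).
Proof.
move=> hu; rewrite {2}/eop (lin_fsum (va_linearr u s)); last exact/fsupp_scale/fsupp_L.
pose B n := \sum_(j < n) ratr (gbinom n.+1%:R j.+2) *:
  Y (L j.+1%:Z u) (s + (n - j.+1)%N%:Z) v.
have [J [Q JQ]] := mode_L_bounded u v s.
have B0 n : (J + Q < n)%N -> B n = 0.
  move=> nJQ; rewrite /B big1 // => j _; rewrite JQ ?scaler0 //.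
  by have := ltn_ord j; lia.
have sA : fsupp (fun n : nat =>
    ratr (ecoef n * (n.+1%:R * k%:~R - (n.+1%:R + s%:~R))) *: Y u (s + n%:Z) v).
  exact/fsupp_scale/fsupp_Y.
have sB : fsupp (fun n => ratr (ecoef n) *: B n).
  by apply/fsupp_scale/(@fsupp_nat _ _ (J + Q).+1) => n; exact: B0.
have sL : fsupp (fun n : nat => ratr (ecoef n) *: L n%:Z (Y u s v)).
  exact/fsupp_scale/fsupp_L.
have sY : fsupp (fun n : nat => Y u s (ratr (ecoef n) *: L n%:Z v)).
  apply: (fsupp_map (f := fun _ => Y u s)) => [_|]; first exact: Y0r.
  exact/fsupp_scale/fsupp_L.
transitivity (fsum (fun n : nat => ratr (ecoef n * (n.+1%:R * k%:~R - (n.+1%:R + s%:~R)))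
    *: Y u (s + n%:Z) v) + fsum (fun n => ratr (ecoef n) *: B n)).
  apply/eqP; rewrite -fsumD // subr_eq -fsumD //; last exact: fsuppD.
  apply/eqP/eq_fsum => n; apply/eqP; rewrite -subr_eq (linZ (va_linearr u s)).
  by rewrite -scalerBr (L_mode_comm n s v hu) scalerDr scalerA -rmorphM.
congr (_ + _); rewrite fsum_recl // {1}/B big_ord0 scaler0 add0r.
pose H j i := ratr (ecoef j.+1 * gbinom (- j.+1%:R) i) *:
  Y (L j.+1%:Z u) (s + i%:Z) v.
transitivity (fsum (fun n => \sum_(j < n.+1) H j (n - j)%N)).
  apply: eq_fsum => n; rewrite /B scaler_sumr; apply: eq_bigr => j _.
  rewrite scalerA -rmorphM subSS /H; congr (ratr _ *: _).
  have jn : (j <= n)%N by rewrite -ltnS.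
  by rewrite -ecoef_gbinom // addSn subnKC.
rewrite (@fsum_triangle _ _ J Q) => [|j i ji]; last by rewrite /H JQ ?scaler0.
apply: eq_fsum => j; rewrite (fsum_map (f := *:%R (ratr (ecoef j.+1)))).
- by apply: eq_fsum => i; rewrite scalerA -rmorphM.
- by rewrite scaler0.
- by move=> ? ?; rewrite scalerDr.
- exact/fsupp_scale/fsupp_Y.
Qed.

(* For f = y^l (1 + y)^m with y = e^x - 1,
   f + x df/dx = \sum_n dcoef l m n y^(l + n) (1 + y)^m. *)
Definition dcoef (l : int) (m : rat) (n : nat) : rat :=
  if n == 0%N then l%:~R + 1 else ecoef n * (l%:~R + m * n.+1%:R).

Lemma cyl_eop k l m u v : wt w k u ->
  cyl l m (eop u) v = k%:~R *: cylk k l m u v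
    + fsum (fun j : nat => ratr (ecoef j.+1) *: cylk (k - j.+1%:Z) l m (L j.+1%:Z u) v).
Proof.
move=> hu; rewrite /eop (lin_fsum (cyl_linearl l m v)); last exact/fsupp_scale/fsupp_L.
have fL (n : nat) : cyl l m (ratr (ecoef n) *: L n%:Z u) v
    = ratr (ecoef n) *: cylk (k - n%:Z) l m (L n%:Z u) v.
  by rewrite (linZ (cyl_linearl l m v)) (cyl_wt _ _ _ (wt_L hw n%:Z hu)).
rewrite (eq_fsum fL) fsum_recl.
  congr (_ + _); rewrite hu subr0 /ecoef rmorph1 scale1r.
  exact: linZ (cylk_linearl k l m v) _ _.
have [N hN] := fsupp_natP (fsupp_L u); apply: (@fsupp_nat _ _ N) => n nN.
by rewrite hN // (lin0 (cylk_linearl _ l m v)) scaler0.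
Qed.

(** With k rewritten as kap + 1 - m, what [dcoef] does not account for is [ecoef_sum] for the
    exponent kap. *)
Lemma dcoef_sum k l m q : let kap := m + k%:~R - 1 in
  \sum_(i < q.+1) gbinom kap i *
     (ecoef (q - i) * ((q - i).+1%:R * k%:~R - ((q - i).+1%:R + (l + i%:Z)%:~R)))
  = k%:~R * gbinom kap q - \sum_(n < q.+1) dcoef l m n * gbinom kap (q - n).
Proof.
move=> kap; rewrite (reindex_inj rev_ord_inj) /=.
pose r n : rat := ecoef n * (l%:~R + m * n.+1%:R).
(* At n = 0 the uniform formula [r] gives l + m where [dcoef] has l + 1; the difference 1 - m is
   split off. *)
have -> : \sum_(n < q.+1) dcoef l m n * gbinom kap (q - n)
   = (1 - m) * gbinom kap q + \sum_(n < q.+1) r n * gbinom kap (q - n).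
  rewrite !big_ord_recl /= subn0 addrA; congr (_ + _).
  by rewrite /r /dcoef /= /ecoef; ring.
have h := ecoef_sum kap q.
have hk : k%:~R = kap + 1 - m by rewrite /kap; ring.
transitivity (kap * gbinom kap q - \sum_(n < q.+1) r n * gbinom kap (q - n)).
  rewrite -h -sumrB; apply: eq_bigr => n _.
  have nq : (n <= q)%N by rewrite -ltnS.
  rewrite subSS subKn // intrD hk /r.
  by rewrite -[(q - n)%N%:Z%:~R]/((q - n)%:R); ring.
by rewrite hk; ring.
Qed.

(** [E] grades Y[., x]: [E, Y[u, x]] = Y[E u, x] + x d/dx Y[u, x]. Moving x d/dx onto e^(mx) (e^x -
    1)^l under the residue, by parts, yields the sum of the [dcoef] with a minus sign. *)
Lemma eop_cylk k l m u v : wt w k u ->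
  eop (cylk k l m u v) = cyl l m (eop u) v + cylk k l m u (eop v)
    - fsum (fun n : nat => ratr (dcoef l m n) *: cylk k (l + n%:Z) m u v).
Proof.
move=> hu; rewrite (cyl_eop _ _ _ hu); set kap := m + k%:~R - 1.
set Bj := fsum (fun j : nat => ratr (ecoef j.+1) *: _).
pose c (s : int) (n : nat) : rat := ecoef n * (n.+1%:R * k%:~R - (n.+1%:R + s%:~R)).
have [N XN] := fsupp_natP (fsupp_Y u v l).
have [J [Q JQ]] := mode_L_bounded u v l.
(* [Af] and [Bf] come from the two sums of [eop_mode_comm]: the first gives the weight [k] and the
   [dcoef], the second the components of E u of lower weight. *)
pose Af (i : nat) : V := ratr (gbinom kap i) *:
  fsum (fun n : nat => ratr (c (l + i%:Z) n) *: Y u (l + i%:Z + n%:Z) v).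
pose Bf (i : nat) : V := ratr (gbinom kap i) *: fsum (fun j : nat => ratr (ecoef j.+1) *:
  fsum (fun n : nat => ratr (gbinom (- j.+1%:R) n) *: Y (L j.+1%:Z u) (l + i%:Z + n%:Z) v)).
have sA : fsupp Af.
  apply: (@fsupp_nat _ _ N) => i iN; rewrite /Af fsbig1 ?scaler0 // => n _.
  by rewrite -[l + _ + _]addrA -PoszD XN ?scaler0 // (leq_trans iN) // leq_addr.
have sB : fsupp Bf.
  apply: (@fsupp_nat _ _ Q) => i iQ; rewrite /Bf fsbig1 ?scaler0 // => j _.
  rewrite fsbig1 ?scaler0 // => n _; rewrite -[l + _ + _]addrA -PoszD JQ ?scaler0 //.
  by rewrite (leq_trans iQ) ?orbT // leq_addr.
have hE : eop (cylk k l m u v) = fsum Af + fsum Bf + cylk k l m u (eop v).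
  rewrite /cylk (lin_fsum eop_linear); last exact/fsupp_scale/fsupp_Y.
  rewrite -fsumD // -fsumD; [|exact: fsuppD|exact/fsupp_scale/fsupp_Y].
  apply: eq_fsum => i; rewrite (linZ eop_linear) /Af /Bf -!scalerDr; congr (_ *: _).
  by apply/eqP; rewrite -subr_eq; apply/eqP; exact: eop_mode_comm.
have hA : fsum Af = k%:~R *: cylk k l m u v
    - fsum (fun n : nat => ratr (dcoef l m n) *: cylk k (l + n%:Z) m u v).
  pose H (i n : nat) : V := ratr (gbinom kap i * c (l + i%:Z) n) *: Y u (l + (i + n)%N%:Z) v.
  have -> : fsum Af = fsum (fun i => fsum (H i)).
    apply: eq_fsum => i; rewrite /Af (fsum_map (f := *:%R _)) ?scaler0 //.
    - by apply: eq_fsum => n; rewrite /H scalerA -rmorphM PoszD addrA.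
    - by move=> ? ?; rewrite scalerDr.
    - exact/fsupp_scale/fsupp_Y.
  rewrite -(@fsum_triangle _ _ N N); last first.
    by move=> i n h; rewrite /H XN ?scaler0 //; lia.
  have -> : fsum (fun n : nat => ratr (dcoef l m n) *: cylk k (l + n%:Z) m u v)
      = fsum (fun q : nat => ratr (\sum_(n < q.+1) dcoef l m n * gbinom kap (q - n)) *:
          Y u (l + q%:Z) v).
    rewrite -(fsum_convolution _ _ (fsupp_Y u v l)); apply: eq_fsum => n.
    by congr (_ *: _); apply: eq_fsum => i; rewrite PoszD addrA.
  apply/eqP; rewrite eq_sym subr_eq -fsumD; first last.
  - exact/fsupp_scale/fsupp_Y.
  - apply: (@fsupp_nat _ _ (N + N)) => q qN; rewrite big1 // => i _.
    by rewrite /H XN ?scaler0 //; have := ltn_ord i; lia.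
  rewrite /cylk (fsum_map (f := *:%R _)) ?scaler0 //; first last.
  - exact: fsupp_cylk.
  - by move=> ? ?; rewrite scalerDr.
  apply/eqP/eq_fsum => q; rewrite scalerA.
  transitivity ((\sum_(i < q.+1) ratr (gbinom kap i * c (l + i%:Z) (q - i)%N)) *:
      Y u (l + q%:Z) v + ratr (\sum_(n < q.+1) dcoef l m n * gbinom kap (q - n)) *:
          Y u (l + q%:Z) v); last first.
    congr (_ + _); rewrite scaler_suml; apply: eq_bigr => i _.
    by rewrite /H subnKC // -ltnS.
  rewrite -scalerDl -rmorph_sum /= dcoef_sum -rmorphD /= subrK.
  by rewrite -[in LHS](ratr_int K k) -rmorphM.
have hB : fsum Bf = Bj.
  pose F (j i : nat) : V := ratr (gbinom kap i) *: (ratr (ecoef j.+1) *: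
    fsum (fun n : nat => ratr (gbinom (- j.+1%:R) n) *: Y (L j.+1%:Z u) (l + (i + n)%N%:Z) v)).
  have F0 j i : (J <= j)%N || (Q <= i)%N -> F j i = 0.
    move=> h; rewrite /F fsbig1 ?scaler0 // => n _; rewrite JQ ?scaler0 //.
    by move: h; lia.
  have -> : fsum Bf = fsum (fun i => fsum (F^~ i)).
    apply: eq_fsum => i; rewrite /Bf (fsum_map (f := *:%R _)) ?scaler0 //.
    - apply: eq_fsum => j; congr (_ *: (_ *: _)); apply: eq_fsum => n.
      by rewrite PoszD addrA.
    - by move=> ? ?; rewrite scalerDr.
    - apply: (@fsupp_nat _ _ J) => j jJ; rewrite fsbig1 ?scaler0 // => n _.
      by rewrite -[l + _ + _]addrA -PoszD JQ ?scaler0 // jJ.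
  rewrite -(fsum_exchange F0); apply: eq_fsum => j.
  transitivity (ratr (ecoef j.+1) *: fsum (fun i => ratr (gbinom kap i) *:
    fsum (fun n : nat => ratr (gbinom (- j.+1%:R) n) *: Y (L j.+1%:Z u) (l + (i + n)%N%:Z) v)) : V).
    rewrite [RHS](fsum_map (f := *:%R _)) ?scaler0 //.
    - by apply: eq_fsum => i; rewrite /F !scalerA mulrC.
    - by move=> ? ?; rewrite scalerDr.
    - apply: (@fsupp_nat _ _ Q) => i iQ; rewrite fsbig1 ?scaler0 // => n _.
      by rewrite JQ ?scaler0 //; lia.
  congr (_ *: _); rewrite (fsum_convolution _ _ (fsupp_Y (L j.+1%:Z u) v l)).
  (* kap - (j + 1) is the exponent that [cylk] attaches to L(j + 1) u, of weight k - j - 1. *)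
  apply: eq_fsum => q; rewrite gbinom_vandermonde; congr (ratr (gbinom _ _) *: _).
  by rewrite /kap intrB; ring.
by rewrite hE hA hB [RHS]addrAC; congr (_ + _); rewrite addrAC.
Qed.

Lemma eop_cyl l m u v :
  eop (cyl l m u v) = cyl l m (eop u) v + cyl l m u (eop v)
    - fsum (fun n : nat => ratr (dcoef l m n) *: cyl (l + n%:Z) m u v).
Proof.
move: u; apply: (wt_linear_eq hw).
- by move=> a x y; rewrite (cyl_linearl l m v) eop_linear.
- move=> a x y; rewrite eop_linear !(cyl_linearl l m).
  have hL : linear (fun u => fsum (fun n : nat => ratr (dcoef l m n) *: cyl (l + n%:Z) m u v)).
    apply: (@fsum_linear _ _ _ _ (fun (n : nat) u => _ *: cyl (l + n%:Z) m u v)).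
      by move=> n; apply/scale_linear/cyl_linearl.
    by move=> u; apply/fsupp_scale/fsupp_cyl.
  rewrite hL !scalerDr scalerN opprD !addrA.
  by rewrite [LHS](ACl (1*3*5*2*4*6)).
move=> k u hu; rewrite !(cyl_wt _ _ _ hu) (eop_cylk _ _ _ hu); congr (_ - _).
by apply: eq_fsum => n; rewrite (cyl_wt _ _ _ hu).
Qed.
End Cylinder.

(** * Straightening the cylinder *)

Section StrongRecursion.
Variables (A : Type) (x0 : A) (step : nat -> (nat -> A) -> A).

(** A value depends on all earlier ones, so whole tables are built: [srec_approx n] is correct on
    the arguments up to [n]. *)
Fixpoint srec_approx (n : nat) : nat -> A :=
  if n is n'.+1 then
    fun i => if (i <= n')%N then srec_approx n' i else step n' (srec_approx n')
  else fun=> x0.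

Definition srec (n : nat) : A := srec_approx n n.

Hypothesis step_ext : forall n f g, (forall i, (i <= n)%N -> f i = g i) ->
  step n f = step n g.

Lemma srecS n : srec n.+1 = step n srec.
Proof.
rewrite /srec /= ltnn; apply: step_ext; elim: n => [|n IH] i.
  by rewrite leqn0 => /eqP ->.
rewrite /= leq_eqVlt => /predU1P[-> //|]; rewrite ltnS => i_n.
by rewrite i_n IH.
Qed.
End StrongRecursion.

(* mu l m q is the coefficient of x^(l + q) in e^(m x) (e^x - 1)^l. *)
Definition mu_step (m : rat) (q : nat) (f : nat -> int -> rat) (l : int) : rat :=
  (\sum_(i < q.+1) dcoef l m (q.+1 - i) * f i (l + (q.+1 - i)%N%:Z)) / q.+1%:R.

Definition mu (l : int) (m : rat) (q : nat) : rat :=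
  srec (fun=> 1) (mu_step m) q l.

(** Take the coefficient of x^(l+q+1) in f + x df/dx, expanded by [dcoef]. The left side has the
    factor l + q + 2, and moving the term [dcoef l m 0] = l + 1 over leaves q + 1. *)
Lemma muS l m q : q.+1%:R * mu l m q.+1
  = \sum_(i < q.+1) dcoef l m (q.+1 - i) * mu (l + (q.+1 - i)%N%:Z) m i.
Proof.
rewrite /mu srecS; last first.
  move=> n f g fg; rewrite /mu_step; apply/funext => l'; congr (_ / _).
  by apply: eq_bigr => i _; rewrite fg // -ltnS.
by rewrite /mu_step mulrC divfK // pnatr_eq0.
Qed.

Section Straightening.
Variables (R : realType) (V : vertexAlgebra R) (w : V).
Hypothesis hw : is_voa w.
Local Notation K := R[i].
Local Notation Y := (@va_mode R V).
Local Notation L := (vir w).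

Definition low (k : int) (v : V) : Prop := forall j, k <= j -> wproj hw j v = 0.

Lemma low_wt j k v : wt w j v -> j < k -> low k v.
Proof. by move=> hv jk i ki; rewrite (wproj_id hw i hv) ifF //; lia. Qed.

Lemma low0 k : low k 0.
Proof. by move=> j _; rewrite (lin0 (wproj_linear hw j)). Qed.

Lemma lowD k x y : low k x -> low k y -> low k (x + y).
Proof. by move=> hx hy j kj; rewrite (linD (wproj_linear hw j)) hx // hy // addr0. Qed.

Lemma lowB k x y : low k x -> low k y -> low k (x - y).
Proof. by move=> hx hy j kj; rewrite (linB (wproj_linear hw j)) hx // hy // subr0. Qed.

Lemma lowW j k x : j <= k -> low j x -> low k x.
Proof. by move=> jk hx i ki; apply: hx; lia. Qed.

Lemma low_fsum (I : choiceType) k (F : I -> V) : (forall i, low k (F i)) -> low k (fsum F).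
Proof. by move=> hF; apply: fsum_ind => //; [exact: low0|exact: lowD]. Qed.

Lemma low_ind k (Q : V -> Prop) : Q 0 -> (forall x y, Q x -> Q y -> Q (x + y)) ->
  (forall j v, j < k -> wt w j v -> Q v) -> forall v, low k v -> Q v.
Proof.
move=> Q0 QD Qh v hv; rewrite (wproj_sum hw v); apply: fsum_ind => // j.
have [kj|jk] := lerP k j; first by rewrite hv.
exact: Qh jk (wproj_wt hw j v).
Qed.

Lemma low_top v : exists n : nat, low n%:Z v.
Proof.
have [r hr] := wproj_supp hw v.
exists (\max_(j <- r) `|j|%N).+1 => j rj; apply: hr; apply/negP => jr.
have h : (`|j| <= \max_(j <- r) `|j|)%N := leq_bigmax_seq (F := absz) j jr isT.
by move: rj h; set M := (\max_(_ <- _) _)%N; clearbody M; lia.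
Qed.

Lemma wproj_L j n v : wproj hw j (L n v) = L n (wproj hw (j + n) v).
Proof.
move: v; apply: (wt_linear_eq hw).
- by move=> a x y; rewrite (L_linear w n) (wproj_linear hw).
- by move=> a x y; rewrite (wproj_linear hw) (L_linear w n).
move=> k v hv; rewrite (wproj_id hw _ (wt_L hw n hv)) (wproj_id hw _ hv).
have -> : (j == k - n) = (j + n == k) by lia.
by case: ifP => // _; rewrite (lin0 (L_linear w n)).
Qed.

(** [E] is L(0) plus terms lowering the weight, so a top component of [z] would have as eigenvalue
    its own weight, which is less than [k]. *)
Lemma eop_low_eq0 k z : eop w z = k%:~R *: z -> low k z -> z = 0.
Proof.
move=> hz lowz; apply: (@wt_eq0 _ _ _ hw) => j.
have [|jk] := lerP k j; first exact: lowz.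
have : forall n : nat, low (k - n%:Z) z.
  elim=> [|n IH]; first by rewrite subr0.
  move=> i; rewrite le_eqVlt => /predU1P[<-|hi]; last by apply: IH; lia.
  set a := k - n.+1%:Z.
  have := congr1 (wproj hw a) hz; rewrite (linZ (wproj_linear hw a)).
  rewrite /eop (lin_fsum (wproj_linear hw a)); last exact/fsupp_scale/fsupp_L.
  (* For q > 0, L(q) reaches weight a from weight a + q only, where [z] vanishes by induction. *)
  rewrite (@fsum1 _ _ _ 0%N); last first.
    move=> q q0; rewrite (linZ (wproj_linear hw a)) wproj_L IH ?(lin0 (L_linear w _)) ?scaler0 //.
    by rewrite /a; lia.
  rewrite (linZ (wproj_linear hw a)) wproj_L addr0 (wproj_wt hw a z).
  rewrite /ecoef rmorph1 scale1r => /eqP; rewrite -subr_eq0 -scalerBl scaler_eq0.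
  by rewrite -intrB intr_eq0 /a => /orP[|/eqP //]; lia.
by move=> /(_ `|k - j|%N); apply; lia.
Qed.

(** [tau q] is to be the part of T lowering the weight by q. On weight k, E T = T L(0) reads \sum_(d
    <= q) e_(q-d) L(q-d) tau_d = k tau_q. The term d = q is (k - q) tau_q, so q tau_q is the sum
    over d < q, whatever k is. *)
Definition tau_step (q : nat) (f : nat -> V -> V) (v : V) : V :=
  (q.+1%:R)^-1 *: \sum_(d < q.+1) ratr (ecoef (q.+1 - d)) *: L (q.+1 - d)%N%:Z (f d v).

Definition tau : nat -> V -> V := srec id tau_step.

Lemma tauS q v : q.+1%:R *: tau q.+1 v
  = \sum_(d < q.+1) ratr (ecoef (q.+1 - d)) *: L (q.+1 - d)%N%:Z (tau d v).
Proof.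
rewrite /tau srecS; last first.
  move=> n f g fg; rewrite /tau_step; apply/funext => l'; congr (_ *: _).
  by apply: eq_bigr => i _; rewrite fg // -ltnS.
by rewrite /tau_step scalerA mulfV ?scale1r // pnatr_eq0.
Qed.

Lemma tauSV q v : tau q.+1 v = (q.+1%:R)^-1 *:
  \sum_(d < q.+1) ratr (ecoef (q.+1 - d)) *: L (q.+1 - d)%N%:Z (tau d v).
Proof. by rewrite -tauS scalerA mulVf ?scale1r // pnatr_eq0. Qed.

Lemma tau_linear q : linear (tau q).
Proof.
elim/ltn_ind: q => -[_|q IH]; first by [].
move=> a x y; rewrite !tauSV scalerA mulrC -scalerA -scalerDr; congr (_ *: _).
rewrite scaler_sumr -big_split; apply: eq_bigr => d _ /=.
by rewrite (IH d) // (L_linear w _) scalerDr !scalerA mulrC.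
Qed.

Lemma tau_wt q k v : wt w k v -> wt w (k - q%:Z) (tau q v).
Proof.
move=> hv; elim/ltn_ind: q => -[_|q IH]; first by rewrite subr0.
rewrite tauSV; apply: wtZ; apply: (big_ind (wt w (k - q.+1%:Z))).
- exact: wt0.
- by move=> x y; exact: wtD.
move=> d _; apply: wtZ.
have -> : k - q.+1%:Z = k - d%:Z - (q.+1 - d)%N%:Z by have := ltn_ord d; lia.
exact/(wt_L hw)/IH.
Qed.

Lemma fsupp_tau v : fsupp (tau^~ v).
Proof.
move: v; apply: (wt_ind hw).
- by exists [::] => i _; rewrite (lin0 (tau_linear _)).
- move=> x y hx hy; have [r hr] := fsuppD hx hy.
  by exists r => i /hr; rewrite (linD (tau_linear _)).
move=> k v hv; have [B hB] := wt_bounded hw.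
apply: (@fsupp_nat _ _ `|k - B|%N) => q hq; apply: (hB (k - q%:Z)); first lia.
exact: tau_wt.
Qed.

Definition straighten (v : V) : V := fsum (tau^~ v).

Local Notation T := straighten.

Lemma straighten_linear : linear T.
Proof. exact: fsum_linear tau_linear fsupp_tau. Qed.

Lemma eop_straighten v : eop w (T v) = T (L 0 v).
Proof.
move: v; apply: (wt_linear_eq hw).
- by move=> a x y; rewrite straighten_linear (eop_linear w).
- by move=> a x y; rewrite (L_linear w) straighten_linear.
move=> k v hv; rewrite hv (linZ straighten_linear) /T.
rewrite (lin_fsum (eop_linear w)); last exact: fsupp_tau.
pose H (d n : nat) : V := ratr (ecoef n) *: L n%:Z (tau d v).
have [D hD] := fsupp_natP (fsupp_tau v).
have hQ d := fsupp_natP (fsupp_L w (tau d v)).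
have [Q {}hQ] := choice hQ.
have H0 d n : (D <= d)%N || (\max_(d < D) Q d <= n)%N -> H d n = 0.
  have [dD|dD] := leqP D d; first by rewrite /H hD // (lin0 (L_linear w _)) scaler0.
  move=> /= qn; rewrite /H hQ ?scaler0 //; apply: leq_trans qn.
  exact: (leq_bigmax (F := fun d : 'I_D => Q d) (Ordinal dD)).
rewrite -[LHS](fsum_triangle H0) (fsum_map (f := *:%R k%:~R)) ?scaler0 //; first last.
- exact: fsupp_tau.
- by move=> ? ?; rewrite scalerDr.
apply: eq_fsum => q; rewrite big_ord_recr /= /H subnn.
rewrite (tau_wt q hv) /ecoef rmorph1 scale1r -/ecoef.
have -> : \sum_(d < q) ratr (ecoef (q - d)) *: L (q - d)%N%:Z (tau d v) = q%:R *: tau q v.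
  by case: q => [|q]; [rewrite big_ord0 scale0r|rewrite tauS].
by rewrite -scalerDl; congr (_ *: _); rewrite intrB -pmulrn; ring.
Qed.

Lemma straighten_sub_wt k v : wt w k v -> low k (T v - v).
Proof.
move=> hv; have -> : T v - v = fsum (fun d => tau d.+1 v).
  by rewrite /T (fsum_recl (fsupp_tau v)) addrAC -[tau 0 v]/v subrr add0r.
by apply: low_fsum => d; apply: (low_wt (tau_wt d.+1 hv)); lia.
Qed.

Lemma straighten_sub k v : low (k + 1) v -> low k (T v - v).
Proof.
move: v; apply: low_ind.
- by rewrite (lin0 straighten_linear) subr0; exact: low0.
- by move=> x y hx hy; rewrite (linD straighten_linear) opprD addrACA; exact: lowD.
by move=> j v' jk /straighten_sub_wt; apply: lowW; lia.
Qed.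

Lemma straighten_low k v : low k v -> low k (T v).
Proof.
move=> hv; rewrite -(subrK v (T v)); apply: lowD => //.
by apply: (@lowW (k - 1)); [lia|apply: straighten_sub; rewrite subrK].
Qed.

(** T - id strictly lowers weights: if T v = 0, then v = -(T v - v) lies lower than its own bound,
    and this repeats forever. *)
Lemma straighten_inj : injective T.
Proof.
suff inj0 v : T v = 0 -> v = 0.
  move=> x y xy; apply/eqP; rewrite -subr_eq0; apply/eqP/inj0.
  by rewrite (linB straighten_linear) xy subrr.
move=> hT; have [n0 hn0] := low_top v.
have : forall n : nat, low (n0%:Z - n%:Z) v.
  elim=> [|n IH]; first by rewrite subr0.
  have : low (n0%:Z - n.+1%:Z) (T v - v).
    by apply: straighten_sub; apply: lowW IH; lia.
  rewrite hT sub0r => h j hj; have := h j hj.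
  by rewrite (linN (wproj_linear hw j)) => /eqP; rewrite oppr_eq0 => /eqP.
move=> h; apply: (@wt_eq0 _ _ _ hw) => j; apply: (h `|n0%:Z - j|%N); lia.
Qed.

(** A preimage of [v] is [v] minus a preimage of T v - v, which has lower weights; the descent ends
    because weights are bounded below. *)
Lemma straighten_surj v : exists u, T u = v.
Proof.
have [B hB] := wt_bounded hw.
have main (n : nat) : forall v, low (B + n%:Z) v -> exists u, T u = v.
  elim: n => [|n IH] {}v hv.
    exists 0; rewrite (lin0 straighten_linear); apply/esym/(@wt_eq0 _ _ _ hw) => j.
    have [jB|Bj] := lerP j B; first exact: hB (wproj_wt hw j v).
    by apply: hv; lia.
  have [|u hu] := IH (T v - v).
    by apply: straighten_sub; apply: lowW hv; lia.
  by exists (v - u); rewrite (linB straighten_linear) hu subKr.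
have [n hn] := low_top v; apply: (main `|n%:Z - B|%N).
by apply: lowW hn; lia.
Qed.

Lemma straighten_vac : T (va_vac V) = va_vac V.
Proof.
have L1 n : 0 <= n -> L n (va_vac V) = 0.
  by move=> n0; rewrite /vir va_vacr ?ifF //; lia.
have hv : wt w 0 (va_vac V) by rewrite /wt L1 // scale0r.
rewrite /T (@fsum1 _ _ _ 0%N) //.
elim/ltn_ind => -[//|q IH] _; rewrite tauSV big1 ?scaler0 // => -[[|d] hd] _ /=.
  by rewrite L1 ?scaler0.
by rewrite IH // (lin0 (L_linear w _)) scaler0.
Qed.

(** Each [tau q] is a combination of products of operators L(n). *)
Lemma straighten_aut (g : V -> V) : linear g ->
  (forall n v, g (L n v) = L n (g v)) -> forall v, g (T v) = T (g v).
Proof.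
move=> gL gw v; rewrite /T (lin_fsum gL); last exact: fsupp_tau.
apply: eq_fsum => q; elim/ltn_ind: q => -[//|q IH].
rewrite !tauSV (linZ gL) (lin_sum gL); congr (_ *: _); apply: eq_bigr => d _.
by rewrite (linZ gL) gw IH.
Qed.

Lemma cyl_low l m k p u v : low (k + 1) u -> low (p + 1) v ->
  low (k + p - l) (cyl hw l m u v).
Proof.
move=> hu hv; move: u hu; apply: low_ind.
- by rewrite (lin0 (cyl_linearl hw l m v)); exact: low0.
- by move=> x y; rewrite (linD (cyl_linearl hw l m v)); exact: lowD.
move=> k' u hk hu; move: v hv; apply: low_ind.
- by rewrite (lin0 (cyl_linearr hw l m u)); exact: low0.
- by move=> x y; rewrite (linD (cyl_linearr hw l m u)); exact: lowD.
move=> p' v hp hv; rewrite (cyl_wt hw _ _ _ hu); apply: low_fsum => i.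
by apply: low_wt (wtZ _ (wt_mode hw _ hu hv)) _; lia.
Qed.

(** The first term of [cylk] has coefficient 1 and weight k + p - l - 1; each further term lowers
    the weight by one more. *)
Lemma cyl_top l m k p u v : wt w k u -> wt w p v ->
  low (k + p - l - 1) (cyl hw l m u v - Y u l v).
Proof.
move=> hu hv.
have -> : cyl hw l m u v - Y u l v = fsum (fun i : nat =>
    ratr (gbinom (m + k%:~R - 1) i.+1) *: Y u (l + i.+1%:Z) v).
  rewrite (cyl_wt hw _ _ _ hu) /cylk (fsum_recl (fsupp_cylk _ _ _ _ _)).
  by rewrite gbinom0 rmorph1 scale1r addr0 addrAC subrr add0r.
by apply: low_fsum => i; apply: low_wt (wtZ _ (wt_mode hw _ hu hv)) _; lia.
Qed.

(** Res_x e^(mx) (e^x - 1)^l Y(u, x)v, the cylinder product with Y in place of Y[.,.]. *)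
Definition plane (l : int) (m : rat) (u v : V) : V :=
  fsum (fun q : nat => ratr (mu l m q) *: Y u (l + q%:Z) v).

Lemma plane_linearl l m v : linear (fun u => plane l m u v).
Proof.
apply: (@fsum_linear _ _ _ _ (fun (q : nat) u => _ *: Y u (l + q%:Z) v)).
  by move=> q; apply/scale_linear/va_linearl.
by move=> u; exact/fsupp_scale/fsupp_Y.
Qed.

Lemma plane_linearr l m u : linear (plane l m u).
Proof.
apply: (@fsum_linear _ _ _ _ (fun (q : nat) v => _ *: Y u (l + q%:Z) v)).
  by move=> q; apply/scale_linear/va_linearr.
by move=> v; exact/fsupp_scale/fsupp_Y.
Qed.

Lemma fsupp_plane l m u v : fsupp (fun q : nat => ratr (mu l m q) *: Y u (l + q%:Z) v).
Proof. exact/fsupp_scale/fsupp_Y. Qed.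

(* The difference of the two sides is an eigenvector of [eop] whose eigenvalue
   exceeds all the weights occurring in it. *)
Lemma cyl_straighten_step l m k p u v : wt w k u -> wt w p v ->
  (forall n : nat, cyl hw (l + n.+1%:Z) m (T u) (T v) = T (plane (l + n.+1%:Z) m u v)) ->
  cyl hw l m (T u) (T v) = T (plane l m u v).
Proof.
move=> hu hv IH; set kap := k + p - l - 1.
have hTu : eop w (T u) = k%:~R *: T u by rewrite eop_straighten hu (linZ straighten_linear).
have hTv : eop w (T v) = p%:~R *: T v by rewrite eop_straighten hv (linZ straighten_linear).
have [N XN] := fsupp_natP (fsupp_Y u v l).
pose S := fsum (fun n : nat => ratr (dcoef l m n.+1) *: plane (l + n.+1%:Z) m u v) : V.
have sS : fsupp (fun n : nat => ratr (dcoef l m n.+1) *: plane (l + n.+1%:Z) m u v).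
  apply: (@fsupp_nat _ _ N) => n nN; rewrite /plane fsbig1 ?scaler0 // => q _.
  by rewrite -[l + _ + _]addrA -PoszD XN ?scaler0 //; lia.
(* The term n = 0 of [eop_cyl], with [dcoef] l + 1, turns k + p into kap. The others involve larger
   [l], and the hypothesis rewrites them as T S. *)
have e1 : eop w (cyl hw l m (T u) (T v)) = kap%:~R *: cyl hw l m (T u) (T v) - T S.
  rewrite eop_cyl hTu hTv (linZ (cyl_linearl hw l m _)) (linZ (cyl_linearr hw l m _)).
  rewrite fsum_recl; last exact/fsupp_scale/fsupp_cyl.
  rewrite addr0 opprD addrA -scalerDl -scalerBl; congr (_ *: _ - _).
    by rewrite /dcoef /kap /= rmorphD rmorph1 /= ratr_int !intrD !mulrNz; ring.
  rewrite /S (lin_fsum straighten_linear) //; apply: eq_fsum => n.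
  by rewrite (linZ straighten_linear) IH.
(* The same equation before T is applied: L(0) multiplies the term of index q by kap - q, and [muS]
   identifies the deficit with S. *)
have e2 : L 0 (plane l m u v) = kap%:~R *: plane l m u v - S.
  apply/eqP; rewrite eq_sym subr_eq; apply/eqP.
  pose H (n q : nat) : V := ratr (dcoef l m n.+1 * mu (l + n.+1%:Z) m q) *:
    Y u (l + (n + q).+1%:Z) v.
  have -> : S = fsum (fun n => fsum (H n)).
    apply: eq_fsum => n; rewrite /plane (fsum_map (f := *:%R _)) ?scaler0 //.
    - apply: eq_fsum => q; rewrite /H scalerA -rmorphM -addrA -PoszD addSn //.
    - by move=> ? ?; rewrite scalerDr.
    - exact: fsupp_plane.
  rewrite -(@fsum_triangle _ H N N); last first.
    by move=> n q nq; rewrite /H XN ?scaler0 //; lia.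
  rewrite /plane (lin_fsum (L_linear w 0)); last exact: fsupp_plane.
  rewrite (fsum_map (f := *:%R kap%:~R)) ?scaler0 //; first last.
  - exact: fsupp_plane.
  - by move=> ? ?; rewrite scalerDr.
  have wtY q : L 0 (ratr (mu l m q) *: Y u (l + q%:Z) v)
      = (kap - q%:Z)%:~R *: (ratr (mu l m q) *: Y u (l + q%:Z) v).
    have -> : kap - q%:Z = k + p - (l + q%:Z) - 1 by rewrite /kap; lia.
    exact/wtZ/wt_mode.
  rewrite (eq_fsum wtY) [LHS]fsum_recl; last first.
    by apply: fsupp_scale; exact: fsupp_plane.
  rewrite [X in _ = X + _]fsum_recl; last first.
    by apply: fsupp_scale; exact: fsupp_plane.
  rewrite subr0 -[RHS]addrA; congr (_ + _); first by rewrite subr0.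
  rewrite -fsumD; first last.
  - apply: (@fsupp_nat _ _ (N + N)) => q qN; rewrite big1 // => i _.
    by rewrite /H XN ?scaler0 //; have := ltn_ord i; lia.
  - have [N' hN'] := fsupp_natP (fsupp_plane l m u v).
    by apply: (@fsupp_nat _ _ N') => q qN; rewrite hN' ?scaler0 // ltnW.
  apply: eq_fsum => q.
  have -> : \sum_(j < q.+1) H j (q - j)%N = ratr (q.+1%:R * mu l m q.+1) *: Y u (l + q.+1%:Z) v.
    rewrite muS (reindex_inj rev_ord_inj) rmorph_sum scaler_suml /=.
    apply: eq_bigr => i _; rewrite /H subSS subSn -1?ltnS //.
    by rewrite subKn -1?ltnS // subnK -1?ltnS.
  rewrite [ratr (q.+1%:R * _)]rmorphM /= ratr_nat -[X in _ = _ + X]scalerA -scalerDl; congr (_ *: _).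
  by rewrite intrB -[q.+1%:Z%:~R]/(q.+1%:R); ring.
have lowT x : low kap (x - Y u l v) -> low kap (T x - Y u l v).
  move=> hx; have -> : T x - Y u l v = (T (Y u l v) - Y u l v) + T (x - Y u l v).
    by rewrite (linB straighten_linear) [RHS]addrC addrA subrK.
  apply: lowD; last exact: straighten_low.
  by apply: straighten_sub_wt; exact: wt_mode.
have l1 : low kap (T (plane l m u v) - Y u l v).
  apply: lowT; have -> : plane l m u v - Y u l v
     = fsum (fun q : nat => ratr (mu l m q.+1) *: Y u (l + q.+1%:Z) v).
    rewrite /plane fsum_recl; last exact: fsupp_plane.
    by rewrite /mu /srec /= rmorph1 scale1r addr0 addrAC subrr add0r.
  apply: low_fsum => q; apply: low_wt (wtZ _ (wt_mode hw _ hu hv)) _.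
  by rewrite /kap; lia.
have l2 : low kap (cyl hw l m (T u) (T v) - Y u l v).
  have lu : low k (T u - u) by exact: straighten_sub_wt.
  have lv : low p (T v - v) by exact: straighten_sub_wt.
  have lu1 : low (k + 1) u by apply: low_wt hu _; lia.
  have lv1 : low (p + 1) v by apply: low_wt hv _; lia.
  (* Replacing T u by u, then T v by v, only alters weights below kap. *)
  have -> : cyl hw l m (T u) (T v) - Y u l v = (cyl hw l m u v - Y u l v)
      + cyl hw l m (T u - u) (T v) + cyl hw l m u (T v - v).
    rewrite (linB (cyl_linearl hw l m _)) (linB (cyl_linearr hw l m _)).
    by rewrite -[RHS]addrA [X in _ = _ + X]addrA subrK [RHS]addrC [RHS]addrA subrK.
  apply: lowD; first apply: lowD.
  - exact: cyl_top.
  - have -> : kap = (k - 1) + p - l by rewrite /kap; lia.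
    by apply: cyl_low; rewrite ?subrK //; apply: straighten_low.
  - have -> : kap = k + (p - 1) - l by rewrite /kap; lia.
    by apply: cyl_low; rewrite ?subrK.
apply/eqP; rewrite -subr_eq0; apply/eqP/(@eop_low_eq0 kap).
  rewrite (linB (eop_linear w)) e1 eop_straighten e2.
  by rewrite (linB straighten_linear) (linZ straighten_linear) scalerBr opprB addrA subrK.
have -> : cyl hw l m (T u) (T v) - T (plane l m u v)
  = (cyl hw l m (T u) (T v) - Y u l v) - (T (plane l m u v) - Y u l v) by rewrite opprB addrA subrK.
exact: lowB.
Qed.

(** Downward induction on [l]: by truncation both sides vanish for large [l]. *)
Lemma cyl_straighten l m u v : cyl hw l m (T u) (T v) = T (plane l m u v).
Proof.
move: u; apply: (wt_linear_eq hw).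
- by move=> a x y; rewrite straighten_linear (cyl_linearl hw l m).
- by move=> a x y; rewrite (plane_linearl l m v) straighten_linear.
move=> k u hu; move: v; apply: (wt_linear_eq hw).
- by move=> a x y; rewrite straighten_linear (cyl_linearr hw l m).
- by move=> a x y; rewrite (plane_linearr l m u) straighten_linear.
move=> p v hv.
have [N1 h1] := fsupp_natP (fsupp_cyl hw 0 m (T u) (T v)).
have [N2 h2] := fsupp_natP (fsupp_Y u v 0).
have big (l' : int) : (N1 + N2)%N%:Z <= l' ->
    cyl hw l' m (T u) (T v) = T (plane l' m u v).
  move=> hl; have -> : l' = 0 + `|l'|%N%:Z by lia.
  rewrite h1; last lia.
  rewrite /plane fsbig1 ?(lin0 straighten_linear) // => q _.
  by rewrite -addrA -PoszD h2 ?scaler0 //; lia.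
have down (n : nat) : forall l' : int, (N1 + N2)%N%:Z - n%:Z <= l' ->
    cyl hw l' m (T u) (T v) = T (plane l' m u v).
  elim: n => [|n IH] l' hl; first by apply: big; lia.
  by apply: (cyl_straighten_step hu hv) => j; apply: IH; lia.
by apply: (down `|(N1 + N2)%N%:Z - l|%N); lia.
Qed.
End Straightening.

(** * The comparison map between two conformal vectors *)

Section Comparison.
Variables (R : realType) (V : vertexAlgebra R) (w w' : V).
Hypotheses (hw : is_voa w) (hw' : is_voa w').

(** The clause on [g] serves to make [phi] preserve the eigenspaces of the automorphism; it holds
    because both straightenings are built from modes of [w] and [w']. *)
Lemma cylinder_comparison : exists phi psi : V -> V,
  [/\ linear phi, cancel phi psi, cancel psi phi, phi (va_vac V) = va_vac V
    & forall (l : int) (m : rat) (u v : V),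
      phi (cyl hw l m u v) = cyl hw' l m (phi u) (phi v)]
  /\ forall g : V -> V, linear g -> (forall n v, g (vir w n v) = vir w n (g v)) ->
      (forall n v, g (vir w' n v) = vir w' n (g v)) -> forall v, g (phi v) = phi (g v).
Proof.
have [S TS] := choice (straighten_surj hw); have [S' TS'] := choice (straighten_surj hw').
have ST : cancel (straighten w) S by move=> v; apply: (straighten_inj hw); rewrite TS.
have ST' : cancel (straighten w') S' by move=> v; apply: (straighten_inj hw'); rewrite TS'.
have SL : linear S.
  by move=> a x y; apply: (straighten_inj hw); rewrite (straighten_linear hw) !TS.
have TL' := straighten_linear hw'.
exists (straighten w' \o S), (straighten w \o S'); split; first split.
- by move=> a x y; rewrite /= SL TL'.
- by move=> v; rewrite /= ST' TS.
- by move=> v; rewrite /= ST TS'.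
- by rewrite /= -{1}(straighten_vac w) ST straighten_vac.
- move=> l m u v /=; rewrite cyl_straighten -{1}(TS u) -{1}(TS v) cyl_straighten.
  by rewrite ST.
move=> g gL gw gw' v /=; rewrite (straighten_aut hw' gL gw').
congr (straighten _ _); apply: (straighten_inj hw).
by rewrite -(straighten_aut hw gL gw) !TS.
Qed.
End Comparison.

(** * Twisted modules *)

Section RootsOfUnity.
Variables (R : realType) (T : nat).
Hypothesis T_gt0 : (0 < T)%N.
Local Notation zeta := (@Defs.root_of_unity R T).

Lemma root_of_unityD r s : zeta (r + s)%N = zeta r * zeta s.
Proof.
rewrite /Defs.root_of_unity.
have -> : 2 * pi * (r + s)%:R / T%:R = 2 * pi * r%:R / T%:R + 2 * pi * s%:R / T%:R :> R.
  by rewrite natrD mulrDr mulrDl.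
rewrite cosD sinD; apply/eqP; rewrite eq_complex /=; apply/andP; split; apply/eqP; ring.
Qed.

Lemma root_of_unity0 : zeta 0 = 1.
Proof. by rewrite /Defs.root_of_unity mulr0 mul0r cos0 sin0 oppr0. Qed.

Lemma root_of_unityX r : zeta r = zeta 1 ^+ r.
Proof.
elim: r => [|r IH]; first by rewrite root_of_unity0 expr0.
by rewrite -addn1 root_of_unityD IH exprD expr1.
Qed.

Lemma root_of_unityT : zeta T = 1.
Proof.
rewrite /Defs.root_of_unity mulfK ?pnatr_eq0 -?lt0n //.
by rewrite mulr_natl cos2pi sin2pi oppr0.
Qed.

(** The real part is cos(2x) with x = pi r/T strictly between 0 and pi; were it 1, sin x would
    vanish. *)
Lemma root_of_unity_neq1 r : (0 < r < T)%N -> zeta r != 1.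
Proof.
move=> /andP[r0 rT]; apply/negP; rewrite /Defs.root_of_unity eq_complex /= => /andP[/eqP h _].
set x := pi * r%:R / T%:R : R.
have hx : 2 * pi * r%:R / T%:R = x *+ 2 by rewrite /x -mulr_natl; ring.
have T0 : (0 : R) < T%:R by rewrite ltr0n.
have : 0 < sin x.
  apply: sin_gt0_pi; apply/andP; split.
    by rewrite /x divr_gt0 // mulr_gt0 ?pi_gt0 ?ltr0n.
  by rewrite /x ltr_pdivrMr // ltr_pM2l ?pi_gt0 // ltr_nat.
move: h; rewrite hx cos_mulr2n => h.
have := cos2Dsin2 x; set c := cos x in h *; set s := sin x => h2 s0.
have : s ^+ 2 = 0 by lra.
by move=> /eqP; rewrite sqrf_eq0 => /eqP s00; rewrite s00 ltxx in s0.
Qed.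

Lemma root_of_unity_neq0 r : zeta r != 0.
Proof.
have h : zeta 1 ^+ T != 0 by rewrite -root_of_unityX root_of_unityT oner_eq0.
by rewrite root_of_unityX expf_neq0 //; move: h; rewrite expf_eq0 T_gt0.
Qed.

Lemma sum_root_of_unity j : (j < T)%N ->
  \sum_(r < T) (zeta j)^-1 ^+ r = if j == 0%N then T%:R else 0.
Proof.
case: eqP => [->|/eqP j0] jT.
  by rewrite root_of_unity0 invr1; under eq_bigr do rewrite expr1n; rewrite sumr_const card_ord.
have x1 : (zeta j)^-1 - 1 != 0.
  by rewrite subr_eq0 invr_eq1 root_of_unity_neq1 // lt0n j0.
apply: (mulfI x1); rewrite mulr0 -subrX1 exprVn [zeta j]root_of_unityX exprAC.
by rewrite -[zeta 1 ^+ T]root_of_unityX root_of_unityT expr1n invr1 subrr.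
Qed.

(** Discrete Fourier transform: the component of index r is the average over j of (zeta r)^(-j) g^j
    v. *)
Lemma aut_decomposition (V : vertexAlgebra R) (g : {linear V -> V}) :
  iter T g =1 id -> forall v, exists f : nat -> V,
    (forall r, aut_eigenspace g T r (f r)) /\ v = \sum_(r < T) f r.
Proof.
move=> gT v.
pose h (r j : nat) : V := (zeta r)^-1 ^+ j *: iter j g v.
have hT r : h r T = h r 0%N.
  rewrite /h gT expr0 exprVn [zeta r]root_of_unityX exprAC.
  by rewrite -[zeta 1 ^+ T]root_of_unityX root_of_unityT expr1n invr1.
have T0 : (T%:R : R[i]) != 0 by rewrite pnatr_eq0 -lt0n.
exists (fun r => T%:R^-1 *: \sum_(j < T) h r j); split => [r|].
  rewrite /aut_eigenspace /= linearZ /= scalerA mulrC -scalerA; congr (_ *: _).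
  rewrite linear_sum /=.
  have -> : \sum_(j < T) h r j = \sum_(j < T) h r j.+1.
    case: (T) hT => [|T'] hT; first by rewrite !big_ord0.
    by rewrite big_ord_recl [RHS]big_ord_recr /= hT addrC.
  rewrite scaler_sumr; apply: eq_bigr => j _; rewrite /h linearZ /= scalerA exprS mulrA.
  by rewrite divff ?mul1r // root_of_unity_neq0.
rewrite -scaler_sumr exchange_big /=.
transitivity (T%:R^-1 *: (T%:R *: v)); first by rewrite scalerA mulVf // scale1r.
congr (_ *: _); rewrite (bigD1 (Ordinal T_gt0)) //= [X in _ = _ + X]big1 ?addr0.
  by rewrite /h; under eq_bigr do rewrite expr0 scale1r; rewrite sumr_const card_ord scaler_nat.
(* The coefficient of g^j v is the sum over r of (zeta r)^(-j) = (zeta j)^(-r), which is 0 for j <>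
   0. *)
move=> j j0; rewrite /h -scaler_suml.
under eq_bigr => r _ do rewrite [zeta r]root_of_unityX -exprVn exprAC exprVn -root_of_unityX.
by rewrite sum_root_of_unity // ifF ?scale0r //; apply/negbTE.
Qed.
End RootsOfUnity.

Section TwistedModule.
Variables (R : realType) (V : vertexAlgebra R) (g : {linear V -> V}) (T : nat).
Hypothesis hT : has_order g T.
Variable M : weakTwistedModule g T.

(** [tm_trunc] concerns eigenvectors and indices in r/T + Z; decomposing [u] and using [tm_expo] for
    the other indices extends it. *)
Lemma tm_truncated (u : V) (x : M) : truncated (fun a => tm_mode u a x).
Proof.
case: hT => T0 gT _; have [f [fE ->]] := aut_decomposition T0 gT u.
move=> a; apply: (big_ind (fun u => fsupp (fun i : nat => tm_mode u (a + i%:R) x))).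
- by exists [::] => i _; rewrite (lin0 (tm_linearl _ _)).
- move=> y z hy hz; have [r hr] := fsuppD hy hz.
  by exists r => i /hr; rewrite (linD (tm_linearl _ _)).
move=> r _; have [/intrP[n an]|aint] := boolP (a - r%:R / T%:R \is a Num.int).
  have [N hN] := tm_trunc x (ltn_ord r) (fE r).
  apply: (@fsupp_nat _ _ `|N - n|%N) => i hi.
  have -> : a + i%:R = r%:R / T%:R + (n + i%:Z)%:~R.
    by rewrite intrD -an -[i%:Z%:~R]/(i%:R); ring.
  by apply: hN; lia.
exists [::] => i _; apply: (tm_expo x (ltn_ord r) (fE r)).
apply: contraNN aint => h.
have -> : a - r%:R / T%:R = a + i%:R - r%:R / T%:R - i%:R by ring.
by rewrite rpredB ?rpred_nat.
Qed.
End TwistedModule.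

Section ModeFamilies.
Variables (R : realType) (V : vertexAlgebra R) (M : lmodType R[i]).
Variable YM : V -> rat -> M -> M.
Hypothesis YMl : forall a x, linear (fun u => YM u a x).
Hypothesis YMr : forall u a, linear (YM u a).
Hypothesis YMt : forall u x, truncated (fun a => YM u a x).

Lemma YM0l a x : YM 0 a x = 0. Proof. exact: lin0 (YMl a x). Qed.
Lemma YM0r u a : YM u a 0 = 0. Proof. exact: lin0 (YMr u a). Qed.

Definition bracket (l : int) (m n : rat) (u v : V) (x : M) : M :=
  fsum (term12 YM u v x l%:~R m n) - (-1) ^ l *: fsum (term21 YM u v x l%:~R m n).

Lemma bracket_linearl l m n v x : linear (fun u => bracket l m n u v x).
Proof.
have L12 : linear (fun u => fsum (term12 YM u v x l%:~R m n)).
  apply: (@fsum_linear _ _ _ _ (fun (i : nat) u => term12 YM u v x l%:~R m n i)).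
    by move=> i; apply/scale_linear/YMl.
  by move=> u; apply: fsupp_term12 => //; exact: YM0r.
have L21 : linear (fun u => fsum (term21 YM u v x l%:~R m n)).
  apply: (@fsum_linear _ _ _ _ (fun (i : nat) u => term21 YM u v x l%:~R m n i)).
    by move=> i; apply/scale_linear => a y z; rewrite YMl YMr.
  by move=> u; apply: fsupp_term21 => //; exact: YM0r.
move=> a y z; rewrite /bracket L12 (scale_linear _ L21) scalerBr opprD.
by rewrite addrACA.
Qed.

Lemma bracket_linearr l m n u x : linear (fun v => bracket l m n u v x).
Proof.
have L12 : linear (fun v => fsum (term12 YM u v x l%:~R m n)).
  apply: (@fsum_linear _ _ _ _ (fun (i : nat) v => term12 YM u v x l%:~R m n i)).
    by move=> i; apply/scale_linear => a y z; rewrite YMl YMr.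
  by move=> v; apply: fsupp_term12 => //; exact: YM0r.
have L21 : linear (fun v => fsum (term21 YM u v x l%:~R m n)).
  apply: (@fsum_linear _ _ _ _ (fun (i : nat) v => term21 YM u v x l%:~R m n i)).
    by move=> i; apply/scale_linear/YMl.
  by move=> v; apply: fsupp_term21 => //; exact: YM0r.
move=> a y z; rewrite /bracket L12 (scale_linear _ L21) scalerBr opprD.
by rewrite addrACA.
Qed.

Lemma sum_term10_linearl l m n v x :
  linear (fun u => fsum (term10 (mode_rat (@va_mode R V)) YM u v x l%:~R m n)).
Proof.
have YVl b : linear (fun u => mode_rat (@va_mode R V) u b v).
  move=> a y z; rewrite /mode_rat; case: ifP => _; first exact: va_linearl.
  by rewrite scaler0 addr0.
apply: (@fsum_linear _ _ _ _ (fun (i : nat) u =>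
    term10 (mode_rat (@va_mode R V)) YM u v x l%:~R m n i)).
  by move=> i; apply/scale_linear => a y z; rewrite YVl YMl.
move=> u; apply: fsupp_term10; first exact: YM0l.
exact: truncated_mode_rat.
Qed.

Lemma sum_term10_linearr l m n u x :
  linear (fun v => fsum (term10 (mode_rat (@va_mode R V)) YM u v x l%:~R m n)).
Proof.
have YVr b : linear (mode_rat (@va_mode R V) u b).
  move=> a y z; rewrite /mode_rat; case: ifP => _; first exact: va_linearr.
  by rewrite scaler0 addr0.
apply: (@fsum_linear _ _ _ _ (fun (i : nat) v =>
    term10 (mode_rat (@va_mode R V)) YM u v x l%:~R m n i)).
  by move=> i; apply/scale_linear => a y z; rewrite YVr YMl.
move=> v; apply: fsupp_term10; first exact: YM0l.
exact: truncated_mode_rat.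
Qed.

Variables (w : V) (hw : is_voa w).

(* The mode of [u] lowering the degree by [m]: [u_(wt u - 1 + m)]. *)
Definition omode (u : V) (m : rat) (x : M) : M :=
  wext hw (fun k u => YM u (m + k%:~R - 1) x) u.

Lemma omode_linearl m x : linear (fun u => omode u m x).
Proof. exact: (wext_linear hw (fun k => YMl _ x)). Qed.

Lemma omode_wt k u m x : wt w k u -> omode u m x = YM u (m + k%:~R - 1) x.
Proof. exact: (wext_id hw (fun k => YMl (m + k%:~R - 1) x)). Qed.

Lemma omode_linearr u m : linear (omode u m).
Proof.
apply: (@fsum_linear _ _ _ _ (fun k x => YM (wproj hw k u) (m + k%:~R - 1) x)).
  by move=> k; exact: YMr.
move=> x; exact: (fsupp_wext hw (fun k => YMl (m + k%:~R - 1) x)).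
Qed.

Lemma omode_truncated u x : truncated (fun m => omode u m x).
Proof.
move: u; apply: (wt_ind hw).
- by move=> a; exists [::] => i _; rewrite (lin0 (omode_linearl _ _)).
- move=> y z hy hz a; have [r hr] := fsuppD (hy a) (hz a).
  by exists r => i /hr; rewrite (linD (omode_linearl _ _)).
move=> k u hu a; have [r hr] := YMt u x (a + k%:~R - 1).
exists r => i /hr <-; rewrite (omode_wt _ _ hu); congr (YM u _ x); ring.
Qed.
End ModeFamilies.

(** * The Borcherds identity on the cylinder *)

Section CylinderBorcherds.
Variables (R : realType) (V : vertexAlgebra R) (w : V).
Hypothesis hw : is_voa w.
Variables (M : lmodType R[i]) (YM : V -> rat -> M -> M).
Hypothesis YMl : forall a x, linear (fun u => YM u a x).
Hypothesis YMr : forall u a, linear (YM u a).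
Hypothesis YMt : forall u x, truncated (fun a => YM u a x).
Local Notation OM := (omode YM hw).

(** Every term is shifted alike, by k - 1 in the index of [u] and by p - 1 in that of [v]; [l], and
    with it the binomials, stays. *)
Lemma bracket_omode k p l m n u v x : wt w k u -> wt w p v ->
  bracket OM l m n u v x = bracket YM l (m + k%:~R - 1) (n + p%:~R - 1) u v x.
Proof.
move=> hu hv; rewrite /bracket; congr (_ - _ *: _); apply: eq_fsum => i.
  rewrite /term12 !(omode_wt YMl hw _ _ hu) (omode_wt YMl hw _ _ hv).
  by congr (_ *: YM u _ (YM v _ x)); ring.
rewrite /term21 (omode_wt YMl hw _ _ hv) !(omode_wt YMl hw _ _ hu).
by congr (_ *: YM v _ (YM u _ x)); ring.
Qed.

(** Y u (l + i) v has weight k + p - l - i - 1, which cancels [l] from the degree, and the exponent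
    m + k - 1 in [cylk] is the shifted first index, so the binomials agree. *)
Lemma omode_cyl k p l m n u v x : wt w k u -> wt w p v ->
  OM (cyl hw l m u v) (m + n + l%:~R) x
  = fsum (term10 (mode_rat (@va_mode R V)) YM u v x l%:~R
      (m + k%:~R - 1) (n + p%:~R - 1)).
Proof.
move=> hu hv; rewrite (cyl_wt hw _ _ _ hu) /cylk.
rewrite (lin_fsum (omode_linearl YMl hw _ x)); last exact: fsupp_cylk.
apply: eq_fsum => i; rewrite (linZ (omode_linearl YMl hw _ x)) /term10.
rewrite (omode_wt YMl hw _ _ (wt_mode hw (l + i%:Z) hu hv)).
rewrite -[l%:~R + i%:R](intrD _ l i%:Z) mode_ratE; congr (_ *: YM _ _ x).
by rewrite !intrB !intrD -[i%:Z%:~R]/(i%:R); ring.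
Qed.

(** [E] will be an eigenspace of the automorphism. Its stability under [wproj] reduces the claim to
    homogeneous [u], and the shift of [m] by k - 1 preserves integrality. *)
Lemma cyl_borcherds (s : rat) (E : V -> Prop) l m n u v x :
  (forall k u, E u -> E (wproj hw k u)) ->
  (forall u v l m n, E u -> m + s \is a Num.int ->
     borcherds (mode_rat (@va_mode R V)) YM u v x l m n) ->
  E u -> m + s \is a Num.int ->
  bracket OM l m n u v x = OM (cyl hw l m u v) (m + n + l%:~R) x.
Proof.
move=> Ew B Eu mint.
have OMl := omode_linearl YMl hw; have OMr := omode_linearr YMl YMr hw.
have OMt := omode_truncated YMl YMt hw.
rewrite (wproj_sum hw u) (lin_fsum (bracket_linearl OMl OMr OMt _ _ _ v x)) ?(lin_fsum (cyl_linearl hw l m v)); try exact: wproj_supp.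
rewrite (lin_fsum (OMl _ x)); last first.
  apply: (fsupp_map (f := fun _ u => cyl hw l m u v)) (wproj_supp hw u) => _.
  exact: lin0 (cyl_linearl hw l m v).
apply: eq_fsum => k; have hu := wproj_wt hw k u; have := Ew k u Eu.
move: (wproj hw k u) hu => {Eu}u hu Eu.
move: v; apply: (wt_linear_eq hw).
- exact: (bracket_linearr OMl OMr OMt).
- by move=> a y z; rewrite (cyl_linearr hw l m u) OMl.
move=> p v hv; rewrite (bracket_omode _ _ _ _ hu hv) (omode_cyl _ _ _ _ hu hv).
apply: B => //.
have -> : m + k%:~R - 1 + s = m + s + (k - 1)%:~R by rewrite intrB; ring.
by rewrite rpredD ?intr_int.
Qed.

Lemma borcherds_of_cyl (s : rat) (E : V -> Prop) l m n u v x :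
  (forall k u, E u -> E (wproj hw k u)) ->
  (forall k p u v m n, E u -> m + s \is a Num.int -> wt w k u -> wt w p v ->
     bracket OM l m n u v x = OM (cyl hw l m u v) (m + n + l%:~R) x) ->
  E u -> m + s \is a Num.int ->
  borcherds (mode_rat (@va_mode R V)) YM u v x l m n.
Proof.
move=> Ew B Eu mint; rewrite /borcherds -/(bracket YM l m n u v x).
rewrite (wproj_sum hw u) (lin_fsum (bracket_linearl YMl YMr YMt _ _ _ v x)); last exact: wproj_supp.
rewrite (lin_fsum (sum_term10_linearl YMl _ _ _ v x)); last exact: wproj_supp.
apply: eq_fsum => k; have hu := wproj_wt hw k u; have := Ew k u Eu.
move: (wproj hw k u) hu => {Eu}u hu Eu.
move: v; apply: (wt_linear_eq hw).
- exact: (bracket_linearr YMl YMr YMt).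
- exact: (sum_term10_linearr YMl).
move=> p v hv.
have em : m = m - k%:~R + 1 + k%:~R - 1 by ring.
have en : n = n - p%:~R + 1 + p%:~R - 1 by ring.
rewrite {}em {}en -(bracket_omode _ _ _ _ hu hv) -(omode_cyl _ _ _ _ hu hv).
apply: B hu hv => //.
have -> : m - k%:~R + 1 + s = m + s - (k - 1)%:~R by rewrite intrB; ring.
by rewrite rpredB ?intr_int.
Qed.
End CylinderBorcherds.

(** * Transport of admissible modules *)

Section Automorphisms.
Variables (R : realType) (V : vertexAlgebra R) (w : V) (g : {linear V -> V}).
Hypotheses (hw : is_voa w) (hg : is_voa_aut w g).

Lemma aut_vir n v : g (vir w n v) = vir w n (g v).
Proof. by rewrite /vir (aut_mode hg) (aut_conf hg). Qed.

(** [g] fixes [w], hence commutes with L(0) and preserves its eigenspaces. *)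
Lemma aut_wproj k v : g (wproj hw k v) = wproj hw k (g v).
Proof.
have gL : linear g by exact: linearP.
move: v; apply: (wt_linear_eq hw).
- by move=> a x y; rewrite (wproj_linear hw) gL.
- by move=> a x y; rewrite gL (wproj_linear hw).
move=> j v hv; have hgv : wt w j (g v) by rewrite /wt -aut_vir hv linearZ.
rewrite (wproj_id hw _ hv) (wproj_id hw _ hgv).
by case: ifP => // _; rewrite linear0.
Qed.

Lemma aut_eigenspace_wproj T r k u :
  aut_eigenspace g T r u -> aut_eigenspace g T r (wproj hw k u).
Proof.
rewrite /aut_eigenspace /= => hu.
by rewrite aut_wproj hu (linZ (wproj_linear hw k)).
Qed.

Lemma wt_vac : wt w 0 (va_vac V).
Proof. by rewrite /wt /vir va_vacr // scale0r. Qed.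
End Automorphisms.

Lemma in_invTZ_shift (T : nat) (k : int) (a : rat) :
  in_invTZ T (a + k%:~R) <-> in_invTZ T a.
Proof.
rewrite /in_invTZ mulrDr; have h : T%:R * k%:~R \is a @Num.int rat.
  by rewrite rpredM ?rpred_nat ?intr_int.
split=> h'; last by rewrite rpredD.
by rewrite -[T%:R * a](addrK (T%:R * k%:~R)) rpredB.
Qed.

(** * Modules for [w'] made into modules for [w] *)

Section Transport.
Variables (R : realType) (V : vertexAlgebra R) (w w' : V).
Hypotheses (hw : is_voa w) (hw' : is_voa w').
Variables (g : {linear V -> V}) (T : nat).
Hypotheses (hg : is_voa_aut w g) (hg' : is_voa_aut w' g) (hT : has_order g T).
Variables (phi psi : V -> V).
Hypotheses (phiL : linear phi) (psiK : cancel psi phi).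
Hypothesis phi_vac : phi (va_vac V) = va_vac V.
Hypothesis phi_cyl : forall (l : int) (m : rat) (u v : V),
  phi (cyl hw l m u v) = cyl hw' l m (phi u) (phi v).
Hypothesis phi_aut : forall v, g (phi v) = phi (g v).

Section Module.
Variable M : admissibleModule w' g T.
Local Notation YM := (@tm_mode R V g T M).
Local Notation OM := (omode YM hw').

Let YMl := @tm_linearl R V g T M.
Let YMr := @tm_linearr R V g T M.
Let YMt := tm_truncated hT (M := M).
Let OMl := omode_linearl YMl hw'.
Let OMr := omode_linearr YMl YMr hw'.
Let OMt := omode_truncated YMl YMt hw'.

(* Chosen so that the degree-lowering modes are [OM (phi u) m]. *)
Definition new_mode (u : V) (a : rat) (x : M) : M :=
  wext hw (fun k u => OM (phi u) (a - k%:~R + 1) x) u.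

Let FL k a x : linear (fun u => OM (phi u) (a - k%:~R + 1) x).
Proof. by move=> b y z; rewrite phiL OMl. Qed.

Lemma new_mode_linearl a x : linear (fun u => new_mode u a x).
Proof. exact: (wext_linear hw (fun k => FL k a x)). Qed.

Lemma new_mode_wt k u a x : wt w k u ->
  new_mode u a x = OM (phi u) (a - k%:~R + 1) x.
Proof. exact: (wext_id hw (fun k => FL k a x)). Qed.

Lemma new_mode_linearr u a : linear (new_mode u a).
Proof.
apply: (@fsum_linear _ _ _ _ (fun k x => OM (phi (wproj hw k u)) (a - k%:~R + 1) x)).
  by move=> k; exact: OMr.
by move=> x; exact: (fsupp_wext hw (fun k => FL k a x)).
Qed.

Lemma new_mode_truncated u x : truncated (fun a => new_mode u a x).
Proof.
move: u; apply: (wt_ind hw).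
- by move=> a; exists [::] => i _; rewrite (lin0 (new_mode_linearl _ _)).
- move=> y z hy hz a; have [r hr] := fsuppD (hy a) (hz a).
  by exists r => i /hr; rewrite (linD (new_mode_linearl _ _)).
move=> k u hu a; have [r hr] := OMt (phi u) x (a - k%:~R + 1).
exists r => i /hr <-; rewrite (new_mode_wt _ _ hu); congr (OM (phi u) _ x); ring.
Qed.

Lemma omode_new u m x : omode new_mode hw u m x = OM (phi u) m x.
Proof.
move: u; apply: (wt_linear_eq hw).
- exact: (omode_linearl new_mode_linearl hw m x).
- by move=> b y z; rewrite phiL OMl.
move=> k u hu; rewrite (omode_wt new_mode_linearl hw _ _ hu) (new_mode_wt _ _ hu).
by congr (OM (phi u) _ x); ring.
Qed.

Lemma phi_eigenspace r u : aut_eigenspace g T r u -> aut_eigenspace g T r (phi u).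
Proof. by rewrite /aut_eigenspace /= phi_aut => ->; rewrite (linZ phiL). Qed.

Lemma omode_expo r u m x : (r < T)%N -> aut_eigenspace g T r u ->
  m - r%:R / T%:R \isn't a Num.int -> OM u m x = 0.
Proof.
move=> rT Eu mint; rewrite /omode /wext fsbig1 // => k _.
apply: (tm_expo x rT (aut_eigenspace_wproj hw' hg' k Eu)).
apply: contraNN mint => h.
have -> : m - r%:R / T%:R = m + k%:~R - 1 - r%:R / T%:R - (k - 1)%:~R.
  by rewrite intrB; ring.
by rewrite rpredB ?intr_int.
Qed.

Lemma new_mode_expo (r : nat) (u : V) (n : rat) (x : M) : (r < T)%N ->
  aut_eigenspace g T r u -> n - r%:R / T%:R \isn't a Num.int -> new_mode u n x = 0.
Proof.
move=> rT Eu mint; rewrite /new_mode /wext fsbig1 // => k _.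
apply: (omode_expo x rT (phi_eigenspace (aut_eigenspace_wproj hw hg k Eu))).
apply: contraNN mint => h.
have -> : n - r%:R / T%:R = n - k%:~R + 1 - r%:R / T%:R + (k - 1)%:~R.
  by rewrite intrB; ring.
by rewrite rpredD ?intr_int.
Qed.

Lemma new_mode_invTZ (u : V) (n : rat) (x : M) : ~ in_invTZ T n -> new_mode u n x = 0.
Proof.
move=> hn; rewrite /new_mode /wext fsbig1 // => k _.
rewrite /omode /wext fsbig1 // => j _; apply: tm_invTZ => h; apply: hn.
apply/(in_invTZ_shift _ (j - k)); move: h.
suff -> : n - k%:~R + 1 + j%:~R - 1 = n + (j - k)%:~R by [].
by rewrite intrB; ring.
Qed.

Lemma new_mode_vac (n : rat) (x : M) :
  new_mode (va_vac V) n x = if n == -1 then x else 0.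
Proof.
rewrite (new_mode_wt _ _ (wt_vac w)) phi_vac (omode_wt YMl hw' _ _ (wt_vac w')) tm_vac.
by have -> : n - 0%:~R + 1 + 0%:~R - 1 = n by ring.
Qed.

Lemma new_mode_trunc (r : nat) (u : V) (x : M) : (r < T)%N ->
  aut_eigenspace g T r u ->
  exists N : int, forall n : int, N <= n -> new_mode u (r%:R / T%:R + n%:~R) x = 0.
Proof.
move=> _ _; have [N hN] := fsupp_natP (new_mode_truncated u x (r%:R / T%:R)).
exists N%:Z => n Nn; have -> : n = `|n|%N%:Z by lia.
by apply: hN; lia.
Qed.

(** The identity is reduced to the cylinder for [w], carried by [phi_cyl] to the cylinder for [w'],
    and obtained there from the Jacobi identity of [M]. *)
Lemma new_mode_jacobi (r : nat) (u v : V) (x : M) : (r < T)%N ->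
  aut_eigenspace g T r u ->
  jacobi (mode_rat (@va_mode R V)) new_mode (- (r%:R / T%:R)) u v x.
Proof.
move=> rT Eu.
have M0r y a : new_mode y a 0 = 0 by exact: lin0 (new_mode_linearr y a).
have M0l a y : new_mode 0 a y = 0 by exact: lin0 (new_mode_linearl a y).
apply: (borcherds_jacobi M0r M0l).
- exact: new_mode_truncated.
- exact: new_mode_truncated.
- by move=> l; exact: truncated_mode_rat.
- by move=> a aint; rewrite /mode_rat (negbTE aint).
- by move=> a y; exact: new_mode_expo.
move=> l m n mint.
apply: (borcherds_of_cyl new_mode_linearl new_mode_linearr new_mode_truncated
  (hw := hw) (s := - (r%:R / T%:R)) (E := aut_eigenspace g T r)) => //.
  by move=> k y; exact: aut_eigenspace_wproj.
move=> {u v Eu m n mint} k p u v m n Eu mint hu hv.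
rewrite omode_new phi_cyl -(cyl_borcherds YMl YMr YMt (hw := hw')
  (s := - (r%:R / T%:R)) (E := aut_eigenspace g T r)) //.
- by rewrite /bracket; congr (_ - _ *: _); apply: eq_fsum => i;
    rewrite /term12 /term21 !omode_new.
- by move=> j y; exact: aut_eigenspace_wproj.
- move=> y z l' m' n' Ey m'int.
  apply: (jacobi_borcherds (YM0r YMr) (YM0l YMl) (YMt y x) (YMt z x) n') m'int _.
    exact: tm_jacobi.
  exact: truncated_mode_rat.
- exact: phi_eigenspace.
Qed.

Definition new_weak : weakTwistedModule g T :=
  WeakTwistedModule new_mode_linearl new_mode_linearr new_mode_invTZ
    new_mode_expo new_mode_vac new_mode_trunc new_mode_jacobi.

Lemma grade_fsum (I : choiceType) n (F : I -> M) :
  (forall i, am_grade n (F i)) -> am_grade n (fsum F).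
Proof.
have [/(_ n)[h0 hD _] _ _] := am_direct M.
by move=> hF; apply: fsum_ind.
Qed.

Lemma new_mode_grade (k : int) (v : V) (m n : rat) (x : M) :
  wt_space w k%:~R v -> in_invTZ T m -> in_invTZ T n ->
  am_grade n x -> am_grade (n + k%:~R - m - 1) (new_mode v m x).
Proof.
move=> hv hm hn hx; rewrite (new_mode_wt m x (hv : wt w k v)).
apply: grade_fsum => j.
(* Whatever weight j a component of phi v has for [w'], the index of its mode compensates, and the
   degree changes by k - m - 1. *)
have -> : n + k%:~R - m - 1 = n + j%:~R - (m - k%:~R + 1 + j%:~R - 1) - 1 by ring.
apply: am_mode_grade => //; first exact: wproj_wt.
have -> : m - k%:~R + 1 + j%:~R - 1 = m + (j - k)%:~R by rewrite intrB; ring.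
exact/in_invTZ_shift.
Qed.

Definition new_module : admissibleModule w g T :=
  @AdmissibleModule R V w g T new_weak (@am_grade _ _ _ _ _ M)
    (@am_grade0 _ _ _ _ _ M) (am_direct M) new_mode_grade.

Lemma subspace_fsum (N : set M) (I : choiceType) (F : I -> M) : is_subspace N ->
  (forall i, N (F i)) -> N (fsum F).
Proof. by move=> [h0 hD _] hF; apply: fsum_ind. Qed.

Lemma new_submodule (N : set M) :
  is_adm_submodule (M := new_module) N <-> is_adm_submodule (M := M) N.
Proof.
split=> -[Nsub Nmode Ndir]; split=> // v n x Nx.
- rewrite (wproj_sum hw' v) (lin_fsum (YMl n x)); last exact: wproj_supp.
  apply: subspace_fsum => // k.
  (* A mode of [M] is a degree mode of the new module at the preimage under [phi], so stability
     under the new modes gives stability under the old ones. *)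
  have -> : YM (wproj hw' k v) n x = OM (phi (psi (wproj hw' k v))) (n - k%:~R + 1) x.
    rewrite psiK (omode_wt YMl hw' _ _ (wproj_wt hw' k v)).
    by congr (YM _ _ x); ring.
  by rewrite -omode_new; apply: subspace_fsum => // j; exact: (Nmode _ _ _ Nx).
- apply: subspace_fsum => // k; apply: subspace_fsum => // j.
  exact: Nmode.
Qed.

Lemma new_irr_submodule (N : set M) :
  is_irr_adm_submodule (M := new_module) N -> is_irr_adm_submodule (M := M) N.
Proof.
move=> [/new_submodule Nadm N0 Nmin]; split=> // N' /new_submodule N'adm N'N.
exact: Nmin.
Qed.

End Module.

Lemma g_rational_transport : g_rational w g T -> g_rational w' g T.
Proof.
move=> rat M; have [I [N [Nirr Nsum]]] := rat (new_module M).
by exists I, N; split=> // i; exact/new_irr_submodule/Nirr.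
Qed.
End Transport.

Lemma g_rational_imp (R : realType) (V : vertexAlgebra R) (w w' : V)
    (hw : is_voa w) (hw' : is_voa w') (g : {linear V -> V}) (T : nat) :
  is_voa_aut w g -> is_voa_aut w' g -> has_order g T ->
  g_rational w g T -> g_rational w' g T.
Proof.
move=> hg hg' hT.
have [phi [psi [[phiL _ psiK phi_vac phi_cyl] phi_aut]]] := cylinder_comparison hw hw'.
apply: (g_rational_transport hg hg' hT phiL psiK phi_vac phi_cyl).
by apply: phi_aut; [exact: linearP|exact: aut_vir|exact: aut_vir].
Qed.

Theorem theorem4p4 (R : realType) (V : vertexAlgebra R) (w w' : V)
    (hw : is_voa w) (hw' : is_voa w')
    (g : {linear V -> V}) (T : nat)
    (hg : is_voa_aut w g) (hg' : is_voa_aut w' g) (hT : has_order g T) :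
  g_rational w g T <-> g_rational w' g T.
Proof. by split; exact: g_rational_imp. Qed.
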